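(* Fix $(\theta,\beta)\in(0,1)^2$ and $\alpha>0$ such that $\alpha>\eta^{clu}_\theta(\beta)$. Consider the clustering problem (estimating $\ell$ from $X$) in the ARW model with parameters $(\alpha,\beta,\theta)$. Then for any clustering procedure $\hat\ell=\hat\ell(X)\in\{-1,1\}^n$, $$\liminf_{p\to\infty}\mathrm{Hamm}_p(\hat\ell,\alpha,\beta,\theta)\ \ge\ \tfrac12 .$$
   Context: ARW model. For each $p$ let $n=n_p=p^\theta$ (treated as an integer), $\epsilon_p=p^{-\beta}$, $\tau_p=p^{-\alpha}$. The labels $\ell_1,\dots,\ell_n$ are i.i.d. uniform on $\{-1,1\}$; the coordinates of $\mu\in\mathbb R^p$ are i.i.d., equal to $\tau_p$ with probability $\epsilon_p$ and to $0$ with probability $1-\epsilon_p$; $Z$ is an $n\times p$ matrix with i.i.d. $N(0,1)$ entries; $\ell,\mu,Z$ are independent. One observes $X=\ell\mu'+Z\in\mathbb R^{n\times p}$, i.e. the $i$-th row is $X_i=\ell_i\mu+Z_i$. Clustering error. $\mathrm{Hamm}_p(\hat\ell,\alpha,\beta,\theta)=n^{-1}\inf_{\pi\in\Pi}\sum_{i=1}^n P(\hat\ell_i\ne\pi(\ell_i))$, where $\Pi$ is the set of the two permutations of $\{-1,1\}$ and $P$ is over $(\mu,\ell,Z)$. The curve $\eta^{clu}_\theta$: $$\eta^{clu}_\theta(\beta)=\begin{cases}(1-2\beta)/2,&\beta\le(1-\theta)/2,\\ \theta/2,&(1-\theta)/2\le\beta\le1-\theta,\\ (1-\beta)/2,&\beta\ge1-\theta.\end{cases}$$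 *)

(* Defs.v *)
From HB Require Import structures.
From mathcomp Require Import all_boot all_order all_algebra perm.
From mathcomp Require Import all_classical all_reals all_analysis.

Set Implicit Arguments.
Unset Strict Implicit.
Unset Printing Implicit Defensive.

Import Order.TTheory GRing.Theory Num.Theory.
Import numFieldNormedType.Exports.

Local Open Scope classical_set_scope.
Local Open Scope ring_scope.

(* The label set {-1, 1} is encoded by bool: true stands for 1 and false
   for -1, so that the permutations of {-1, 1} are the elements of
   {perm bool}. *)
Definition label_val (R : realType) (b : bool) : R := if b then 1 else -1.

(* p^theta is in general not an integer; it is rounded down. *)
Definition arw_n (R : realType) (theta : R) (p : nat) : nat :=
  Num.truncn (p%:R `^ theta).

Definition arw_eps (R : realType) (beta : R) (p : nat) : R := p%:R `^ (- beta).

Definition arw_tau (R : realType) (alpha : R) (p : nat) : R :=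
  p%:R `^ (- alpha).

Definition eta_clu (R : realType) (theta beta : R) : R :=
  if beta <= (1 - theta) / 2 then (1 - 2 * beta) / 2
  else if beta <= 1 - theta then theta / 2
  else (1 - beta) / 2.

Definition mutually_independent (R : realType) (d : measure_display)
    (T : measurableType d) (P : probability T R) (I : finType)
    (Y : I -> T -> R) : Prop :=
  forall (J : {set I}) (B : I -> set R),
    (forall k, measurable (B k : set (measurableTypeR R))) ->
    P (\bigcap_(k in [set` J]) (Y k @^-1` B k)) =
    (\prod_(k in J) P (Y k @^-1` B k))%E.

Definition arw_coord (R : realType) (d : measure_display)
    (T : measurableType d) (P : probability T R) (n p : nat)
    (ell : 'I_n -> {RV P >-> bool}) (mu : 'I_p -> {RV P >-> R})
    (Z : 'I_n -> 'I_p -> {RV P >-> R})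
    (k : ('I_n + 'I_p + 'I_n * 'I_p)%type) : T -> R :=
  match k with
  | inl (inl i) => fun w => label_val R (ell i w)
  | inl (inr j) => fun w => mu j w
  | inr (i, j) => fun w => Z i j w
  end.

(* Independence within each of the i.i.d. families ell, mu, Z together with
   the independence of ell, mu and Z is the mutual independence of the family
   of all their coordinates. *)
Record arw_model (R : realType) (n p : nat) (eps tau : R)
    (d : measure_display) (T : measurableType d) (P : probability T R)
    (ell : 'I_n -> {RV P >-> bool}) (mu : 'I_p -> {RV P >-> R})
    (Z : 'I_n -> 'I_p -> {RV P >-> R}) : Prop := ARWModel {
  arw_ell_law : forall (i : 'I_n) (b : bool),
    P [set w | ell i w = b] = (2^-1)%:E ;
  arw_mu_law : forall j : 'I_p,
    P [set w | mu j w = tau] = eps%:E /\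
    P [set w | mu j w = 0] = (1 - eps)%:E ;
  arw_Z_law : forall (i : 'I_n) (j : 'I_p) (B : set (measurableTypeR R)),
    measurable B -> distribution P (Z i j) B = normal_prob 0 1 B ;
  arw_indep : mutually_independent P (arw_coord ell mu Z)
}.

Definition arw_X (R : realType) (n p : nat) (d : measure_display)
    (T : measurableType d) (P : probability T R)
    (ell : 'I_n -> {RV P >-> bool}) (mu : 'I_p -> {RV P >-> R})
    (Z : 'I_n -> 'I_p -> {RV P >-> R}) (w : T) : 'M[R]_(n, p) :=
  (\col_i label_val R (ell i w)) *m (\col_j mu j w)^T + \matrix_(i, j) Z i j w.

(* The sigma-algebra that these sets generate is the Borel one on n x p
   matrices. *)
Definition mx_cylinders (R : realType) (n p : nat) : set (set 'M[R]_(n, p)) :=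
  [set A | exists (i : 'I_n) (j : 'I_p) (B : set (measurableTypeR R)),
    measurable B /\ A = [set M : 'M[R]_(n, p) | B (M i j)]].

Definition clustering_procedure (R : realType) (n p : nat)
    (hatl : 'M[R]_(n, p) -> 'I_n -> bool) : Prop :=
  forall i : 'I_n,
    measurable_fun [set: g_sigma_algebraType (@mx_cylinders R n p)]
      (fun M : g_sigma_algebraType (@mx_cylinders R n p) => hatl M i).

Definition hamm (R : realType) (n p : nat) (d : measure_display)
    (T : measurableType d) (P : probability T R)
    (ell : 'I_n -> {RV P >-> bool}) (mu : 'I_p -> {RV P >-> R})
    (Z : 'I_n -> 'I_p -> {RV P >-> R})
    (hatl : 'M[R]_(n, p) -> 'I_n -> bool) : \bar R :=
  ((n%:R^-1)%:E *
   ereal_inf [set (\sum_(i < n)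
       P [set w | hatl (arw_X ell mu Z w) i != pi (ell i w)])
     | pi in [set: {perm bool}]])%E.

(* Main.v *)
From HB Require Import structures.
Require Import Defs.
From mathcomp Require Import all_boot all_order all_algebra perm.
From mathcomp Require Import all_classical all_reals all_analysis.
From mathcomp Require Import measurable_realfun ring lra.

Set Implicit Arguments.
Unset Strict Implicit.
Unset Printing Implicit Defensive.

Import Order.TTheory GRing.Theory Num.Theory.
Import numFieldNormedType.Exports.

Local Open Scope classical_set_scope.
Local Open Scope ring_scope.

(* The infimum over permutations is outside the expectation, so it suffices to
   show that each label is guessed with probability at most 1/2 + o(1).  Reveal
   all labels but the i-th: by Cameron-Martin, the law of X given the labels l
   has with respect to that of pure noise Z the density
     F_l = prod_j (1 - eps + eps * exp (tau <Z_j, l> - n tau^2 / 2)),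
   a product over the p independent columns Z_j.  Guessing label i amounts to
   testing F_l against F_l', where l' flips label i, and the success probability
   exceeds 1/2 by at most a multiple of the square root of p times the squared
   Hellinger distance of one column.  That squared distance is bounded both by
   eps tau^2 (joint convexity, i.e. revealing mu as well) and, when
   n tau^2 <= 1, by a multiple of eps^2 tau^2 (chi-square bound).  Above the curve eta^clu the
   first bound is o(1/p) if alpha > (1 - beta)/2, the second one if
   alpha > max(theta/2, (1 - 2 beta)/2). *)

(** * Independent coordinates *)

(** Nothing is conditioned on. The event that one label is guessed correctly is cut into cells on
    which all labels and the support of [mu] are fixed. On a cell, X is noise translated by a known
    matrix, so Cameron-Martin turns the probability into an integral over pure noise. Summing over
    the supports collapses 2^p Gaussian shifts into a product over columns. All label vectors are
    thus compared under the one law of the noise, and they are paired by the involution that flips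
    label i. The obstacle is the growing number of columns: total variation does not tensorize,
    whereas the Hellinger affinity of independent columns is exactly the product of their
    affinities. The square root in the passage from Hellinger distance to testing error is never
    taken: AM-GM with a free weight [lam], chosen only at the end, replaces it. Neither column bound
    suffices alone. The chi-square bound costs a factor exp (n tau^2), unbounded when alpha <
    theta/2; revealing the support loses a factor eps. *)

Section coordinate_space.
Context {R : realType} {I : finType}.

(* Rectangles rather than cylinders, because they already form a pi-system. *)
Definition rectangles : set (set (I -> R)) :=
  [set A | exists B : I -> set (measurableTypeR R),
    (forall k, measurable (B k)) /\ A = [set v | forall k, B k (v k)]].

Definition coord_space := g_sigma_algebraType rectangles.

Lemma rectangles_measurable (A : set coord_space) :
  rectangles A -> measurable A.
Proof. exact: sub_sigma_algebra. Qed.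

Lemma rectangles_setI : setI_closed rectangles.
Proof.
move=> _ _ [B [mB ->]] [C [mC ->]].
exists (fun k => B k `&` C k); split; first by move=> k; exact: measurableI.
apply/seteqP; split=> v /=; first by move=> [? ?] k; split.
by move=> BC; split=> k; have [] := BC k.
Qed.

Lemma rectangles_setT : rectangles setT.
Proof.
exists (fun=> setT); split; first by move=> k; exact: measurableT.
by apply/seteqP; split.
Qed.

Lemma measurable_coord (k : I) :
  measurable_fun [set: coord_space]
    (fun v : coord_space => v k : measurableTypeR R).
Proof.
move=> _ B mB; rewrite setTI; apply: rectangles_measurable.
exists (fun k' => if k' == k then B else setT); split.
  by move=> k'; case: ifP.
apply/seteqP; split=> v /=; last by move=> /(_ k); rewrite eqxx.
by move=> Bv k'; case: ifP => // /eqP ->.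
Qed.

Lemma measurable_into_coord_space (d : measure_display) (T : measurableType d)
    (f : T -> coord_space) :
  (forall k, measurable_fun [set: T] (fun t => f t k : measurableTypeR R)) ->
  measurable_fun [set: T] f.
Proof.
move=> mf; apply: (@measurability _ _ T coord_space setT f rectangles erefl).
move=> _ [_ [B [mB ->]] <-]; rewrite setTI.
have -> : f @^-1` [set v | forall k, B k (v k)] =
    \big[setI/setT]_(k : I) ((fun t => f t k) @^-1` B k).
  apply/seteqP; split=> t /=.
    by move=> Bt; elim/big_ind: _ => //= *; split.
  by move=> + k; rewrite (bigD1 k)//= => -[].
apply: bigsetI_measurable => k _; rewrite -[X in measurable X]setTI.
exact: mf.
Qed.

(** Projection onto the coordinates in [S] that stays inside the same space; 0 is an arbitrary
    filler. The preimages under [restr S] play the role of the sigma-algebra generated by these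
    coordinates. *)
Definition restr (S : {set I}) (v : coord_space) : coord_space :=
  fun k => if k \in S then v k else 0.

Lemma measurable_restr (S : {set I}) :
  measurable_fun [set: coord_space] (restr S).
Proof.
apply: measurable_into_coord_space => k; rewrite /restr.
by case: (k \in S); [exact: measurable_coord|exact: measurable_cst].
Qed.

HB.instance Definition _ (S : {set I}) :=
  isMeasurableFun.Build _ _ coord_space coord_space (restr S)
    (measurable_restr S).

Lemma restr_restr (S S' : {set I}) (v : coord_space) :
  S \subset S' -> restr S (restr S' v) = restr S v.
Proof.
move=> SS'; apply/funext => k; rewrite /restr.
by case: ifP => // kS; rewrite (fintype.subsetP SS').
Qed.

(** Stated as factorization through [restr S], so that measurability on the whole space is enough
    and no sub-sigma-algebra has to be carried along. *)
Definition depends_on (T : Type) (S : {set I}) (f : coord_space -> T) :=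
  forall v, f (restr S v) = f v.

Lemma depends_onS (T : Type) (S S' : {set I}) (f : coord_space -> T) :
  S \subset S' -> depends_on S f -> depends_on S' f.
Proof.
by move=> SS' fS v; rewrite -(fS (restr S' v)) restr_restr// fS.
Qed.

End coordinate_space.
Arguments coord_space : clear implicits.

(** The hypothesis identifies the joint law of [X] and [Y] with the product of their laws, by
    uniqueness of product measures; Tonelli then separates the integral. *)
Lemma ge0_integral_mul_indep (d d1 d2 : measure_display) (T : measurableType d)
    (T1 : measurableType d1) (T2 : measurableType d2) (R : realType)
    (Q : probability T R) (X : {mfun T >-> T1}) (Y : {mfun T >-> T2})
    (f : T1 -> R) (g : T2 -> R) :
  (forall A B, measurable A -> measurable B ->
    Q (X @^-1` A `&` Y @^-1` B) = (Q (X @^-1` A) * Q (Y @^-1` B))%E) ->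
  measurable_fun setT f -> measurable_fun setT g ->
  (forall x, 0 <= f x) -> (forall y, 0 <= g y) ->
  (\int[Q]_t (f (X t) * g (Y t))%:E =
    (\int[Q]_t (f (X t))%:E) * (\int[Q]_t (g (Y t))%:E))%E.
Proof.
move=> XY mf mg f0 g0.
pose XY2 (t : T) := (X t, Y t).
have mXY2 : measurable_fun setT XY2 by exact/measurable_fun_pairP.
pose F (z : T1 * T2) := (f z.1 * g z.2)%:E.
have mF : measurable_fun setT F.
  apply/measurable_EFinP; apply: measurable_funM.
    exact: measurableT_comp mf measurable_fst.
  exact: measurableT_comp mg measurable_snd.
have F0 z : (0 <= F z)%E by rewrite lee_fin mulr_ge0.
transitivity (\int[pushforward Q XY2]_z F z)%E.
  by rewrite ge0_integral_pushforward.
transitivity (\int[(distribution Q X \x distribution Q Y)%E]_z F z)%E.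
  pose XYm : {mfun T >-> (T1 * T2)%type} := mfun_Sub (mem_set mXY2).
  apply: eq_measure_integral => D mD _; apply/esym.
  exact: (@product_measure_unique _ _ _ _ _
    (distribution Q X) (distribution Q Y)
    (distribution Q XYm)).
have mF1 : measurable_fun setT (EFin \o f) by exact/measurable_EFinP.
have mG1 : measurable_fun setT (EFin \o g) by exact/measurable_EFinP.
have F1ge0 x : (0 <= (EFin \o f) x)%E by rewrite lee_fin.
have G1ge0 y : (0 <= (EFin \o g) y)%E by rewrite lee_fin.
have intX : (\int[Q]_t (f (X t))%:E = \int[distribution Q X]_x (f x)%:E)%E.
  by rewrite (@ge0_integral_distribution _ _ _ _ _ Q X (EFin \o f) mF1 F1ge0).
have intY : (\int[Q]_t (g (Y t))%:E = \int[distribution Q Y]_y (g y)%:E)%E.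
  by rewrite (@ge0_integral_distribution _ _ _ _ _ Q Y (EFin \o g) mG1 G1ge0).
rewrite fubini_tonelli1// intX intY /fubini_F /F/=.
have inner x : (\int[distribution Q Y]_y (f x * g y)%:E =
    (f x)%:E * \int[distribution Q Y]_y (g y)%:E)%E.
  under eq_integral do rewrite EFinM.
  by rewrite ge0_integralZl// => *; rewrite lee_fin.
rewrite (eq_integral _ _ (fun x _ => inner x)) ge0_integralZr//.
  by move=> *; rewrite lee_fin.
by apply: integral_ge0 => *; rewrite lee_fin.
Qed.

Section independence.
Context {R : realType} {I : finType} (Q : probability (coord_space R I) R).
Hypothesis indepQ : forall B : I -> set (measurableTypeR R),
  (forall k, measurable (B k)) ->
  Q [set v | forall k, B k (v k)] = (\prod_k Q [set v | B k (v k)])%E.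
Local Notation V := (coord_space R I).

(** Each coordinate lies outside [S] or outside [S']. On that side the constraint only tests the
    filler 0, hence is [setT] or [set0], and the coordinate's factor splits trivially. *)
Lemma restr_rectangles_indep (S S' : {set I}) (A A' : set V) :
  (forall k, k \in S -> k \notin S') -> rectangles A -> rectangles A' ->
  Q (restr S @^-1` A `&` restr S' @^-1` A') =
  (Q (restr S @^-1` A) * Q (restr S' @^-1` A'))%E.
Proof.
move=> SS' [B [mB ->]] [B' [mB' ->]].
pose D (S0 : {set I}) (B0 : I -> set (measurableTypeR R)) k :=
  [set x : measurableTypeR R | B0 k (if k \in S0 then x else 0)].
have mD S0 B0 k : (forall k, measurable (B0 k)) -> measurable (D S0 B0 k).
  move=> mB0; rewrite /D; case: (k \in S0) => /=; first exact: mB0.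
  have [?|?] := pselect (B0 k 0).
    by rewrite (_ : mkset _ = setT)//; apply/seteqP; split.
  by rewrite (_ : mkset _ = set0)//; apply/seteqP; split.
have pre (S0 : {set I}) (B0 : I -> set (measurableTypeR R)) :
    restr S0 @^-1` [set v : V | forall k, B0 k (v k)] =
    [set v : V | forall k, D S0 B0 k (v k)] by [].
rewrite !pre.
have -> : [set v : V | forall k, D S B k (v k)] `&`
    [set v : V | forall k, D S' B' k (v k)] =
    [set v : V | forall k, (D S B k `&` D S' B' k) (v k)].
  apply/seteqP; split=> v /=; first by move=> [? ?] k; split.
  by move=> h; split=> k; have [] := h k.
rewrite (indepQ (fun k => mD S B k mB)) (indepQ (fun k => mD S' B' k mB')).
rewrite (indepQ (fun k => measurableI _ _ (mD S B k mB) (mD S' B' k mB'))).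
rewrite -big_split/=; apply: eq_bigr => k _.
have triv (S0 : {set I}) (B0 : I -> set (measurableTypeR R)) : k \notin S0 ->
    D S0 B0 k = setT \/ D S0 B0 k = set0.
  move=> /negbTE kS; rewrite /D kS; have [?|?] := pselect (B0 k 0).
    by left; apply/seteqP; split.
  by right; apply/seteqP; split.
rewrite (_ : [set v : V | _] =
  [set v : V | D S B k (v k)] `&` [set v : V | D S' B' k (v k)])//.
have preT : [set v : V | [set: measurableTypeR R] (v k)] = setT by [].
have pre0 : [set v : V | (set0 : set (measurableTypeR R)) (v k)] = set0 by [].
have [kS|kS] := boolP (k \in S).
  have [->|->] := triv S' B' (SS' k kS).
    by rewrite preT setIT probability_setT mule1.
  by rewrite pre0 setI0 measure0 mule0.
have [->|->] := triv S B kS.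
  by rewrite preT setTI probability_setT mul1e.
by rewrite pre0 set0I measure0 mul0e.
Qed.

Lemma restr_measurable_indep (S S' : {set I}) (A A' : set V) :
  (forall k, k \in S -> k \notin S') -> measurable A -> measurable A' ->
  Q (restr S @^-1` A `&` restr S' @^-1` A') =
  (Q (restr S @^-1` A) * Q (restr S' @^-1` A'))%E.
Proof.
have mr S0 C : measurable C -> measurable (restr S0 @^-1` C : set V).
  by move=> mC; rewrite -[X in measurable X]setTI; exact: measurable_restr.
(* One factor at a time: [half] extends the product rule from rectangles to
   measurable sets on the left, and is then used on either side. *)
have half S0 C : measurable C ->
    (forall A0, rectangles A0 -> Q (restr S0 @^-1` A0 `&` C) =
      (Q (restr S0 @^-1` A0) * Q C)%E) ->
    forall A0, measurable A0 -> Q (restr S0 @^-1` A0 `&` C) =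
      (Q (restr S0 @^-1` A0) * Q C)%E.
  move=> mC rect A0 mA0.
  have qC : 0 <= fine (Q C) by rewrite fine_ge0.
  have QCE : Q C = (fine (Q C))%:E by rewrite fineK// fin_num_measure.
  have scaleE D : mscale (NngNum qC) (distribution Q (restr S0)) D =
      (Q (restr S0 @^-1` D) * Q C)%E.
    by rewrite muleC [in RHS]QCE.
  rewrite -scaleE.
  (* As functions of [A0] both sides are finite measures: the image of [Q] restricted to [C], and
     the law of [restr S0] scaled by [Q C]. They agree on a pi-system. *)
  apply: (@measure_unique _ R V rectangles (fun=> setT) erefl
    rectangles_setI (fun=> rectangles_setT) _
    (pushforward (mrestr Q mC) (restr S0))
    (mscale (NngNum qC) (distribution Q (restr S0)))) => //.
  - by apply/seteqP; split=> // v _; exists 0%N.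
  - by move=> D rD; apply: etrans (esym (scaleE D)); exact: rect.
  - move=> _; rewrite /= /pushforward /mrestr preimage_setT setTI.
    exact: le_lt_trans (probability_le1 Q mC) (ltry 1).
move=> SS' mA mA'; apply: (half S _ (mr S' A' mA') _ A mA) => B rB.
rewrite setIC muleC.
apply: (half S' _ (mr S B (rectangles_measurable rB)) _ A' mA') => B' rB'.
by rewrite setIC muleC; exact: restr_rectangles_indep.
Qed.

Lemma integral_mul_indep (S S' : {set I}) (f g : V -> R) :
  (forall k, k \in S -> k \notin S') ->
  depends_on S f -> depends_on S' g ->
  measurable_fun setT f -> measurable_fun setT g ->
  (forall v, 0 <= f v) -> (forall v, 0 <= g v) ->
  (\int[Q]_v (f v * g v)%:E = (\int[Q]_v (f v)%:E) * (\int[Q]_v (g v)%:E))%E.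
Proof.
move=> SS' fS gS' mf mg f0 g0.
rewrite -(eq_integral _ _ (fun v _ => congr1 EFin (fS v))).
rewrite -(eq_integral _ _ (fun v _ => congr1 EFin (gS' v))).
rewrite -(@ge0_integral_mul_indep _ _ _ _ _ _ _ Q (restr S) (restr S') f g)//.
  by apply: eq_integral => v _; rewrite fS gS'.
by move=> A B mA mB; exact: restr_measurable_indep.
Qed.

Lemma integral_prod_indep (J : eqType) (s : seq J) (S : J -> {set I})
    (h : J -> V -> R) (c : J -> R) :
  uniq s -> (forall j j' k, j != j' -> k \in S j -> k \notin S j') ->
  (forall j, depends_on (S j) (h j)) ->
  (forall j, measurable_fun setT (h j)) -> (forall j v, 0 <= h j v) ->
  (forall j, \int[Q]_v (h j v)%:E = (c j)%:E)%E ->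
  (\int[Q]_v (\prod_(j <- s) h j v)%:E = (\prod_(j <- s) c j)%:E)%E.
Proof.
move=> us Sdisj hS mh h0 hc; elim: s us => [_|j s IH /= /andP[js us]].
  under eq_integral do rewrite big_nil.
  by rewrite integral_cst// big_nil mul1e; exact: probability_setT.
under eq_integral do rewrite big_cons.
(* By disjointness, the remaining factors depend only on coordinates outside [S j], so the head
   factor can be split off. *)
rewrite (@integral_mul_indep (S j) (~: S j)%SET).
- by rewrite hc IH// big_cons EFinM.
- by move=> k kS; rewrite inE kS.
- exact: hS.
- move=> v; rewrite !big_seq; apply: eq_bigr => j' j's.
  apply: (depends_onS _ (hS j')); apply/fintype.subsetP => k kS.
  rewrite inE; apply/negP => kSj.
  have jj' : j != j' by apply: contraNneq js => ->.
  by have := Sdisj _ _ _ jj' kSj; rewrite kS.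
- exact: mh.
- exact: measurable_prod.
- exact: h0.
- by move=> v; apply: prodr_ge0 => ? _.
Qed.

End independence.

(** * Gaussian shifts *)

Section density_measure.
Local Open Scope ereal_scope.
Context (d : measure_display) (T : measurableType d) (R : realType).
Variables (mu : {measure set T -> \bar R}) (g : T -> R).
Hypotheses (mg : measurable_fun setT g) (g0 : forall t, (0 <= g t)%R).

Definition density_measure (A : set T) := \int[mu]_(t in A) (g t)%:E.

Let mgE : measurable_fun setT (EFin \o g).
Proof. exact/measurable_EFinP. Qed.

Let density0 : density_measure set0 = 0.
Proof. by rewrite /density_measure integral_set0. Qed.

Let density_ge0 A : 0 <= density_measure A.
Proof. by apply: integral_ge0 => t _; rewrite lee_fin. Qed.

Let density_sigma_additive : semi_sigma_additive density_measure.
Proof.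
move=> /= F mF tF mUF; rewrite /density_measure; apply: cvg_toP.
  apply: ereal_nondecreasing_is_cvgn => m n mn.
  apply: lee_sum_nneg_natr => // k _ _.
  by apply: integral_ge0 => /= x Fkx; rewrite lee_fin.
rewrite ge0_integral_bigcup//=.
- exact: measurable_funTS.
- by move=> x _; rewrite lee_fin.
Qed.

HB.instance Definition _ := isMeasure.Build _ _ _ density_measure
  density0 density_ge0 density_sigma_additive.

Definition density : {measure set T -> \bar R} := density_measure.

Import HBNNSimple.

(** By monotone convergence it is enough to treat simple functions, and by additivity the indicator
    of one level set, where the claim is the definition of [density_measure]. *)
Lemma ge0_integral_density (f : T -> \bar R) :
  measurable_fun setT f -> (forall t, 0 <= f t) ->
  \int[density]_t f t = \int[mu]_t (f t * (g t)%:E).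
Proof.
move=> mf f0.
pose f_ := nnsfun_approx measurableT mf.
have cvgf t : (f_ n t)%:E @[n --> \oo] --> f t by exact: cvg_nnsfun_approx.
transitivity (lim (\int[density]_t (f_ n t)%:E @[n --> \oo])).
  rewrite -monotone_convergence//=.
  - by apply: eq_integral => t _; apply/esym/cvg_lim.
  - by move=> n; exact/measurable_EFinP/measurable_funTS.
  - by move=> n ? _; rewrite lee_fin.
  - by move=> ? _ ? ? mn; rewrite lee_fin; exact/lefP/nd_nnsfun_approx.
rewrite [RHS](_ : _ = lim
    (\int[mu]_t ((f_ n t)%:E * (g t)%:E) @[n --> \oo])); last first.
  rewrite -monotone_convergence//=.
  - apply: eq_integral => t _; apply/esym/cvg_lim => //.
    by apply: cvgeZr => //; exact: cvgf.
  - move=> n; apply: emeasurable_funM => //.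
    by exact/measurable_EFinP/measurable_funTS.
  - by move=> n ? _; rewrite lee_fin mulr_ge0.
  - move=> t _ ? ? mn; rewrite -!EFinM lee_fin ler_wpM2r//.
    exact/lefP/nd_nnsfun_approx.
apply: congr_lim; apply/funext => n /=.
have mfn r : measurable (f_ n @^-1` [set r]) by [].
have fr0 r t : 0 <= (r * \1_(f_ n @^-1` [set r]) t)%:E.
  by rewrite EFinM; exact: nnfun_muleindic_ge0.
have fE t : (f_ n t)%:E =
    \sum_(r \in range (f_ n)) (r * \1_(f_ n @^-1` [set r]) t)%:E.
  by rewrite fimfunE -fsumEFin.
have fgE t : (f_ n t)%:E * (g t)%:E =
    \sum_(r \in range (f_ n)) ((r * \1_(f_ n @^-1` [set r]) t)%:E * (g t)%:E).
  by rewrite fE ge0_mule_fsuml.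
rewrite (eq_integral _ _ (fun t _ => fE t)).
rewrite [RHS](eq_integral _ _ (fun t _ => fgE t)).
rewrite [LHS]ge0_integral_fsum//; last by move=> y;
  exact/measurable_EFinP/measurable_funM.
have mfgr r : measurable_fun setT
    (fun t => (r * \1_(f_ n @^-1` [set r]) t)%:E * (g t)%:E).
  by apply: emeasurable_funM => //; exact/measurable_EFinP/measurable_funM.
rewrite [RHS]ge0_integral_fsum//; last first.
  by move=> r t _; apply: mule_ge0; [exact: fr0|rewrite lee_fin].
apply: eq_fsbigr => r rf.
rewrite integralZl_indic_nnsfun// integral_indic// setIT.
(* A negative [r] is not a value of [f_ n], so its level set is empty and both terms vanish. *)
have [r0|r0] := leP 0%R r; last first.
  rewrite preimage_nnfun0// measure0 mule0.
  by rewrite integral0_eq// => t _; rewrite indic0 mulr0 mul0e.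
have mind : measurable_fun setT
    (fun t => (\1_(f_ n @^-1` [set r]) t)%:E * (g t)%:E).
  by apply: emeasurable_funM => //; exact/measurable_EFinP.
have ind0 t : 0 <= (\1_(f_ n @^-1` [set r]) t)%:E * (g t)%:E.
  by rewrite -EFinM lee_fin mulr_ge0.
under [RHS]eq_integral do rewrite EFinM -muleA.
rewrite ge0_integralZl//.
congr (_ * _).
rewrite -[LHS]/(\int[mu]_(t in f_ n @^-1` [set r]) (g t)%:E) integral_mkcond.
apply: eq_integral => t _.
by rewrite patchE indicE; case: ifPn => _; rewrite ?mul1e ?mul0e.
Qed.

End density_measure.

Section lebesgue_translation.
Context {R : realType} (m : R).

Let translation (x : measurableTypeR R) : measurableTypeR R := x + m.

Let measurable_translation : measurable_fun setT translation.
Proof. exact: measurable_funD. Qed.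

HB.instance Definition _ :=
  isMeasurableFun.Build _ _ _ _ translation measurable_translation.

Lemma lebesgue_measure_translate (A : set (measurableTypeR R)) :
  measurable A -> lebesgue_measure [set x : R | A (x + m)] = lebesgue_measure A.
Proof.
move=> mA.
rewrite -[LHS]/(pushforward lebesgue_measure translation A).
apply/esym; apply: lebesgue_measure_unique => //.
move=> _ [[a b] _ <-] /=.
rewrite -[RHS]/(lebesgue_measure (translation @^-1` `]a, b]%classic)).
have -> : translation @^-1` `]a, b]%classic = `]a - m, b - m]%classic.
  by apply/seteqP; split=> x /=; rewrite !in_itv/= ltrBlDr lerBrDr.
by rewrite !lebesgue_measure_itv/= !lte_fin ltrD2r -!EFinD opprB addrA subrK.
Qed.

Lemma ge0_integral_translate (h : R -> \bar R) :
  measurable_fun setT h -> (forall x, 0 <= h x)%E ->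
  (\int[lebesgue_measure]_x h (x + m)%R = \int[lebesgue_measure]_x h x)%E.
Proof.
move=> mh h0.
transitivity (\int[pushforward lebesgue_measure translation]_x h x)%E.
  by rewrite ge0_integral_pushforward.
by apply: eq_measure_integral => A mA _; exact: lebesgue_measure_translate.
Qed.

End lebesgue_translation.

(** Completing the square: m x - m^2/2 - x^2/2 = - (x - m)^2/2. *)
Lemma normal_pdf01_translate (R : realType) (m x : R) :
  expR (m * x - m ^+ 2 / 2) * normal_pdf 0 1 x = normal_pdf 0 1 (x - m).
Proof.
rewrite !normal_pdfE ?oner_eq0//= /normal_fun mulrCA -expRD.
by congr (_ * expR _); field.
Qed.

(** Cameron-Martin in dimension one. *)
Lemma normal_prob_translate (R : realType) (m : R)
    (B : set (measurableTypeR R)) :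
  measurable B ->
  (\int[normal_prob 0 1]_x (\1_B x * expR (m * x - m ^+ 2 / 2))%:E =
   normal_prob 0 1 [set x : R | B (x + m)%R])%E.
Proof.
move=> mB.
have mpdf : measurable_fun setT (@normal_pdf R 0 1).
  exact: measurable_normal_pdf.
have mexp : measurable_fun setT (fun x : R => expR (m * x - m ^+ 2 / 2)).
  by apply: measurableT_comp => //; apply: measurable_funB => //;
    exact: measurable_funM.
have mind : measurable_fun setT (\1_B : measurableTypeR R -> R).
  exact: measurable_indic.
pose D : {measure set (measurableTypeR R) -> \bar R} :=
  density lebesgue_measure (measurable_normal_pdf 0 1) (@normal_pdf_ge0 R 0 1).
rewrite (@eq_measure_integral _ _ _ setT D)//.
rewrite ge0_integral_density; last 2 first.
- exact/measurable_EFinP/measurable_funM.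
- by move=> x; rewrite lee_fin mulr_ge0// expR_ge0.
rewrite /normal_prob [RHS]integral_mkcond.
(* Substituting [x + m] for [x] recentres the shifted density at 0 and moves the shift into [B]. *)
rewrite -(@ge0_integral_translate R m); last 2 first.
- apply: emeasurable_funM; apply/measurable_EFinP => //; exact: measurable_funM.
- by move=> x; rewrite -EFinM lee_fin !mulr_ge0 ?expR_ge0 ?normal_pdf_ge0.
apply: eq_integral => x _.
rewrite -EFinM -mulrA normal_pdf01_translate addrK patchE indicE.
have -> : (x \in [set y : R | B (y + m)]) = (x + m \in B).
  by apply/idP/idP; rewrite !inE.
by case: (x + m \in B); rewrite ?mul1r ?mul0r.
Qed.

(** Likelihood ratio of N(M, Id) against N(0, Id), that is, exp (<M, v> - |M|^2 / 2). A coordinate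
    with [M k = 0] contributes the factor 1, so non-Gaussian coordinates may be present as long as
    they are not shifted. *)
Definition tilt (R : realType) (I : finType) (M : I -> R)
    (v : coord_space R I) : R :=
  \prod_k expR (M k * v k - M k ^+ 2 / 2).

Definition translate (R : realType) (I : finType) (M : I -> R)
    (v : coord_space R I) : coord_space R I := fun k => v k + M k.

Section tilt_theory.
Context {R : realType} {I : finType}.
Local Notation V := (coord_space R I).
Implicit Types M N : I -> R.

Lemma tilt_gt0 M v : 0 < tilt M v.
Proof. by apply: prodr_gt0 => k _; exact: expR_gt0. Qed.

Lemma tilt_ge0 M v : 0 <= tilt M v.
Proof. exact/ltW/tilt_gt0. Qed.

Lemma measurable_tilt_factor (m : R) (k : I) :
  measurable_fun setT (fun v : V => expR (m * v k - m ^+ 2 / 2)).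
Proof.
apply: measurableT_comp => //; apply: measurable_funB => //.
by apply: measurable_funM => //; exact: measurable_coord.
Qed.

Lemma measurable_tilt M : measurable_fun setT (tilt M : V -> R).
Proof. by apply: measurable_prod => k _; exact: measurable_tilt_factor. Qed.

Lemma measurable_translate M : measurable_fun setT (translate M : V -> V).
Proof.
apply: measurable_into_coord_space => k; apply: measurable_funD => //.
exact: measurable_coord.
Qed.

HB.instance Definition _ M :=
  isMeasurableFun.Build _ _ V V (translate M) (measurable_translate M).

Lemma tiltE M v : tilt M v = expR (\sum_k M k * v k - (\sum_k M k ^+ 2) / 2).
Proof. by rewrite /tilt -expR_sum sumrB mulr_suml. Qed.

(** The factor exp <M, N> is half the cross term of |M + N|^2. Since [tilt (M + N)] integrates to 1,
    it is the inner product of the two likelihood ratios, from which chi-square quantities are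
    computed. *)
Lemma tiltM M N v :
  tilt M v * tilt N v = tilt (fun k => M k + N k) v * expR (\sum_k M k * N k).
Proof.
rewrite !tiltE -!expRD; congr expR.
under [in RHS]eq_bigr do rewrite mulrDl.
under [X in _ = _ - X / 2 + _]eq_bigr do rewrite sqrrD.
rewrite !big_split/=.
set a := \sum_k M k * v k; set b := \sum_k N k * v k.
set c := \sum_k M k ^+ 2; set d := \sum_k N k ^+ 2.
set e := \sum_k M k * N k; lra.
Qed.

Lemma depends_on_tilt (S : {set I}) M :
  (forall k, k \notin S -> M k = 0) -> depends_on S (tilt M).
Proof.
move=> MS v; apply: eq_bigr => k _; rewrite /restr; case: ifPn => // kS.
by rewrite MS// !mul0r.
Qed.

End tilt_theory.

Section gaussian_coordinates.
Context {R : realType} {I : finType} (Q : probability (coord_space R I) R).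
Hypothesis indepQ : forall B : I -> set (measurableTypeR R),
  (forall k, measurable (B k)) ->
  Q [set v | forall k, B k (v k)] = (\prod_k Q [set v | B k (v k)])%E.
Variable G : {set I}.
Hypothesis gaussQ : forall k (B : set (measurableTypeR R)), k \in G ->
  measurable B -> Q [set v | B (v k)] = normal_prob 0 1 B.
Local Notation V := (coord_space R I).

Lemma measurable_coord_preimage (B : set (measurableTypeR R)) (k : I) :
  measurable B -> measurable [set v : V | B (v k)].
Proof.
by move=> mB; rewrite -[X in measurable X]setTI; exact: measurable_coord.
Qed.

Lemma measurable_translated_set (m : R) (B : set (measurableTypeR R)) :
  measurable B -> measurable ([set x | B (x + m)] : set (measurableTypeR R)).
Proof.
move=> mB; rewrite -[X in measurable X]setTI.
exact: (measurable_funD (@measurable_id _ _ _) (measurable_cst m)).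
Qed.

Lemma integral_tilt_factor (k : I) (m : R) (B : set (measurableTypeR R)) :
  (k \notin G -> m = 0) -> measurable B ->
  (\int[Q]_v (\1_B (v k) * expR (m * v k - m ^+ 2 / 2))%:E =
   Q [set v | B (v k + m)%R])%E.
Proof.
move=> mG mB; have mBk := measurable_coord_preimage k mB.
have [kG|/mG ->] := boolP (k \in G); last first.
  under eq_integral do rewrite mul0r expr0n/= mul0r subr0 expR0 mulr1.
  under [X in Q X]eq_set do rewrite addr0.
  by rewrite (integral_indic _ measurableT mBk) setIT.
rewrite -[RHS]/(Q [set v : V | [set x | B (x + m)] (v k)]).
rewrite gaussQ//; last exact: measurable_translated_set.
rewrite -normal_prob_translate//.
pose f (x : R) := (\1_B x * expR (m * x - m ^+ 2 / 2)).
have mf : measurable_fun setT (EFin \o f).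
  apply/measurable_EFinP/measurable_funM; first exact: measurable_indic.
  by apply: measurableT_comp => //; apply: measurable_funB => //;
    exact: measurable_funM.
have f0 x : (0 <= (EFin \o f) x)%E by rewrite lee_fin mulr_ge0 ?expR_ge0.
pose Xk : {mfun V >-> measurableTypeR R} :=
  mfun_Sub (mem_set (measurable_coord k)).
transitivity (\int[distribution Q Xk]_x (f x)%:E)%E.
  by rewrite (@ge0_integral_distribution _ _ _ _ _ Q Xk (EFin \o f)).
apply: eq_measure_integral => A mA _.
by rewrite -[LHS]/(Q [set v : V | A (v k)]) gaussQ.
Qed.

(** Both sides are finite measures in [A], so rectangles suffice; there both factor over the
    coordinates and the one-dimensional statement applies to each. Shifts are confined to [G]
    because the other coordinates, later the labels and means, have no Gaussian law. *)
Lemma cameron_martin (M : I -> R) (A : set V) :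
  (forall k, k \notin G -> M k = 0) -> measurable A ->
  Q (translate M @^-1` A) = (\int[Q]_(v in A) (tilt M v)%:E)%E.
Proof.
move=> MG mA.
rewrite -[LHS]/(pushforward Q (translate M) A).
rewrite -[RHS]/(density Q (measurable_tilt M) (tilt_ge0 M) A).
apply: (@measure_unique _ R V rectangles (fun=> setT) erefl
    rectangles_setI (fun=> rectangles_setT) _ (distribution Q (translate M)))
      => //.
- by apply/seteqP; split=> // v _; exists 0%N.
- move=> _ [B [mB ->]].
  rewrite -[LHS]/(Q [set v : V | forall k, [set x | B k (x + M k)] (v k)]).
  rewrite (indepQ (fun k => measurable_translated_set (M k) (mB k))).
  rewrite -[RHS]/(\int[Q]_(v in [set v | forall k, B k (v k)]) (tilt M v)%:E)%E.
  rewrite integral_mkcond.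
  pose h k (v : V) := \1_(B k) (v k) * expR (M k * v k - M k ^+ 2 / 2).
  pose c k := fine (Q [set v | B k (v k + M k)]).
  have mBM k : measurable [set v : V | B k (v k + M k)].
    exact: (measurable_coord_preimage k
      (measurable_translated_set (M k) (mB k))).
  have cE k : Q [set v | B k (v k + M k)] = (c k)%:E.
    by rewrite fineK// fin_num_measure.
  (* The indicator of a rectangle is the product of the indicators of its sides, so the integrand is
     a product of functions of single coordinates. *)
  transitivity (\int[Q]_v (\prod_k h k v)%:E)%E; last first.
    apply: eq_integral => v _; rewrite big_split/= patchE.
    have [vB|vB] := boolP (v \in _).
      by rewrite big1 ?mul1r// => k _; rewrite indicE mem_set//;
        move/set_mem: vB; apply.
    have [k Bk] : exists k, ~ B k (v k).
      by apply/existsNP => Bv; move/negP: vB; apply; exact/mem_set.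
    by rewrite (bigD1 k)//= indicE memNset// !mul0r.
  rewrite (integral_prod_indep indepQ (S := fun k => [set k]%SET) (c := c)).
  - by rewrite -prodEFin; apply: eq_bigr => k _; exact: cE.
  - exact: index_enum_uniq.
  - by move=> k k' i kk'; rewrite !inE => /eqP ->.
  - by move=> k v; rewrite /h /restr inE eqxx.
  - move=> k; apply: measurable_funM; last exact: measurable_tilt_factor.
    exact: (measurableT_comp (measurable_indic (mB k)) (measurable_coord k)).
  - by move=> k v; rewrite mulr_ge0// expR_ge0.
  - by move=> k; rewrite integral_tilt_factor// ?cE//; exact: MG.
- by move=> _; exact: le_lt_trans (probability_le1 _ measurableT) (ltry 1).
Qed.

Lemma integral_tilt (M : I -> R) :
  (forall k, k \notin G -> M k = 0) -> (\int[Q]_v (tilt M v)%:E = 1)%E.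
Proof.
by move=> MG; rewrite -cameron_martin// preimage_setT; exact: probability_setT.
Qed.

End gaussian_coordinates.

(** * Hellinger affinity of sparse mixtures *)

Section nonneg_real_integral.
Context (d : measure_display) (T : measurableType d) (R : realType).
Variable Q : probability T R.
Implicit Types f g : T -> R.

Lemma ge0_integral_addr f g :
  (forall t, 0 <= f t) -> (forall t, 0 <= g t) ->
  measurable_fun setT f -> measurable_fun setT g ->
  (\int[Q]_t (f t + g t)%:E = \int[Q]_t (f t)%:E + \int[Q]_t (g t)%:E)%E.
Proof.
move=> f0 g0 mf mg; under eq_integral do rewrite EFinD.
by rewrite ge0_integralD//; [move=> *; rewrite lee_fin|exact/measurable_EFinP
  |move=> *; rewrite lee_fin|exact/measurable_EFinP].
Qed.

Lemma ge0_integral_scaler (c : R) f :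
  0 <= c -> (forall t, 0 <= f t) -> measurable_fun setT f ->
  (\int[Q]_t (c * f t)%:E = c%:E * \int[Q]_t (f t)%:E)%E.
Proof.
move=> c0 f0 mf; under eq_integral do rewrite EFinM.
by rewrite ge0_integralZl//; [exact/measurable_EFinP|move=> *; rewrite lee_fin].
Qed.

Lemma integral_constr (c : R) : (\int[Q]_t c%:E = c%:E)%E.
Proof.
rewrite integral_cst// -[RHS]mule1; congr (_ * _)%E; exact: probability_setT.
Qed.

Lemma ge0_le_integralr f g :
  (forall t, 0 <= f t) -> measurable_fun setT f -> measurable_fun setT g ->
  (forall t, f t <= g t) -> (\int[Q]_t (f t)%:E <= \int[Q]_t (g t)%:E)%E.
Proof.
move=> f0 mf mg fg; apply: ge0_le_integral => //.
- by move=> *; rewrite lee_fin.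
- exact/measurable_EFinP.
- exact/measurable_EFinP.
- by move=> *; rewrite lee_fin.
Qed.

Lemma measurable_sqrtr f : measurable_fun setT f ->
  measurable_fun setT (fun t => Num.sqrt (f t)).
Proof.
move=> mf; apply: measurableT_comp mf.
apply: continuous_measurable_fun; exact: sqrt_continuous.
Qed.

End nonneg_real_integral.

(** * Pointwise inequalities behind the affinity bounds *)

Section hellinger_inequalities.
Context {R : realType}.
Implicit Types a b : R.

(* For x = sqrt a and y = sqrt b, x^2 - y^2 = (x - y)(x + y) is split by AM-GM
   with weight lam. *)
Lemma maxr_le_hellinger (lam a b : R) : 0 < lam -> 0 <= a -> 0 <= b ->
  Num.max a b + lam / 2 * Num.sqrt (a * b) <=
  (1 / 2 + lam / 4 + 1 / (2 * lam)) * (a + b).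
Proof.
move=> lam0 a0 b0; rewrite sqrtrM//.
set x := Num.sqrt a; set y := Num.sqrt b.
have -> : a = x ^+ 2 by rewrite sqr_sqrtr.
have -> : b = y ^+ 2 by rewrite sqr_sqrtr.
have main u v : u ^+ 2 + lam / 2 * (u * v) <=
    (1 / 2 + lam / 4 + 1 / (2 * lam)) * (u ^+ 2 + v ^+ 2).
  rewrite -subr_ge0.
  have -> : (1 / 2 + lam / 4 + 1 / (2 * lam)) * (u ^+ 2 + v ^+ 2) -
      (u ^+ 2 + lam / 2 * (u * v)) =
      ((lam * (u - v) - (u + v)) ^+ 2 + (u - v) ^+ 2) / (4 * lam).
    by field; rewrite gt_eqF.
  by rewrite divr_ge0 ?addr_ge0 ?sqr_ge0// mulr_ge0// ltW.
rewrite maxEle; case: ifP => _; last exact: main.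
by rewrite [x ^+ 2 + _]addrC [x * y]mulrC; exact: main.
Qed.

(** Cauchy-Schwarz for the vectors (sqrt (1 - eps), sqrt (eps a)) and (sqrt (1 - eps), sqrt (eps
    b)). It is the pointwise form of joint convexity: revealing the mixture component can only lower
    the affinity. *)
Lemma sqrt_mixture_ge (eps a b : R) : 0 <= eps <= 1 -> 0 <= a -> 0 <= b ->
  (1 - eps) + eps * Num.sqrt (a * b) <=
  Num.sqrt (((1 - eps) + eps * a) * ((1 - eps) + eps * b)).
Proof.
move=> /andP[e0 e1] a0 b0; rewrite [in leLHS]sqrtrM//.
set x := Num.sqrt a; set y := Num.sqrt b.
have x0 : 0 <= x by rewrite sqrtr_ge0.
have y0 : 0 <= y by rewrite sqrtr_ge0.
have -> : a = x ^+ 2 by rewrite sqr_sqrtr.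
have -> : b = y ^+ 2 by rewrite sqr_sqrtr.
have e1' : 0 <= 1 - eps by rewrite subr_ge0.
have lhs0 : 0 <= 1 - eps + eps * (x * y) by rewrite addr_ge0 ?mulr_ge0.
rewrite -(ger0_norm lhs0) -sqrtr_sqr ler_wsqrtr//.
rewrite -subr_ge0.
have -> : (1 - eps + eps * x ^+ 2) * (1 - eps + eps * y ^+ 2) -
    (1 - eps + eps * (x * y)) ^+ 2 = (1 - eps) * eps * (x - y) ^+ 2 by ring.
by apply: mulr_ge0; [exact: mulr_ge0|exact: sqr_ge0].
Qed.

(** For the two mixtures u and v, (sqrt u - sqrt v)^2 = (u - v)^2 / (sqrt u + sqrt v)^2. Both are at
    least 1 - eps, so the denominator is at least 4 (1 - eps), while u - v = eps (a - b). The
    unshifted component is what keeps the denominator away from 0. *)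
Lemma mixture_le_sqrt (eps a b : R) : 0 <= eps < 1 -> 0 <= a -> 0 <= b ->
  ((1 - eps) + eps * a) + ((1 - eps) + eps * b) <=
  2 * Num.sqrt (((1 - eps) + eps * a) * ((1 - eps) + eps * b)) +
  eps ^+ 2 / (4 * (1 - eps)) * (a - b) ^+ 2.
Proof.
move=> /andP[e0 e1] a0 b0.
have e1' : 0 < 1 - eps by rewrite subr_gt0.
set u := _ + eps * a; set v := _ + eps * b.
have u1 : 1 - eps <= u by rewrite /u lerDl mulr_ge0.
have v1 : 1 - eps <= v by rewrite /v lerDl mulr_ge0.
have u0 : 0 <= u by exact: le_trans (ltW e1') u1.
have v0 : 0 <= v by exact: le_trans (ltW e1') v1.
have -> : eps ^+ 2 / (4 * (1 - eps)) * (a - b) ^+ 2 =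
    (u - v) ^+ 2 / (4 * (1 - eps)).
  by rewrite /u /v; field; rewrite gt_eqF.
rewrite sqrtrM//.
have uE : Num.sqrt u ^+ 2 = u by rewrite sqr_sqrtr.
have vE : Num.sqrt v ^+ 2 = v by rewrite sqr_sqrtr.
have x0 := sqrtr_ge0 u; have y0 := sqrtr_ge0 v.
move: uE vE x0 y0; set x := Num.sqrt u; set y := Num.sqrt v => uE vE x0 y0.
rewrite -uE -vE in u1 v1 *.
have xy : 1 - eps <= x * y.
  rewrite -(@ler_pXn2r _ 2)// ?nnegrE ?mulr_ge0// ?(ltW e1')//.
  rewrite exprMn expr2; apply: ler_pM => //; exact: ltW.
rewrite -subr_ge0.
have -> : 2 * (x * y) + (x ^+ 2 - y ^+ 2) ^+ 2 / (4 * (1 - eps)) -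
    (x ^+ 2 + y ^+ 2) =
   (x - y) ^+ 2 * ((x + y) ^+ 2 - 4 * (1 - eps)) / (4 * (1 - eps)).
  by field; rewrite gt_eqF.
apply: divr_ge0; last by apply: mulr_ge0 => //; exact: ltW.
apply: mulr_ge0; first exact: sqr_ge0.
have -> : (x + y) ^+ 2 - 4 * (1 - eps) =
  (x ^+ 2 - (1 - eps)) + (y ^+ 2 - (1 - eps)) + 2 * (x * y - (1 - eps)) by ring.
apply: addr_ge0; first by apply: addr_ge0; rewrite subr_ge0.
by apply: mulr_ge0 => //; rewrite subr_ge0.
Qed.

(** From 1 - r P = (1 - r) + r (1 - P), the defects of the factors add up at most. This turns a
    bound for one column into one for all p columns. *)
Lemma one_minus_prod_le (I : Type) (s : seq I) (r : I -> R) (delta : R) :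
  (forall i, 0 <= r i <= 1) -> (forall i, 1 - delta <= r i) ->
  1 - \prod_(i <- s) r i <= (size s)%:R * delta.
Proof.
move=> r01 rd; elim: s => [|i s IH]; first by rewrite big_nil subrr mul0r.
rewrite big_cons /= -natr1 mulrDl mul1r.
have p01 : 0 <= \prod_(i <- s) r i <= 1.
  by elim/big_rec: _ => [|j x _ /andP[x0 x1]]; rewrite ?ler01 ?lexx//;
     have /andP[? ?] := r01 j; rewrite mulr_ge0//= mulr_ile1.
have := r01 i; have := rd i; move: p01 IH.
set P := \prod_(i <- s) r i; set ri := r i.
move=> /andP[P0 P1] IH rid /andP[r0 r1].
have -> : 1 - ri * P = (1 - ri) + ri * (1 - P) by ring.
rewrite addrC lerD//; last by rewrite lerBlDr addrC -lerBlDr.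
by apply: le_trans IH; rewrite ler_piMl// subr_ge0.
Qed.

End hellinger_inequalities.

Section tilt_products.
Context {R : realType} {I : finType} (Q : probability (coord_space R I) R).
Hypothesis indepQ : forall B : I -> set (measurableTypeR R),
  (forall k, measurable (B k)) ->
  Q [set v | forall k, B k (v k)] = (\prod_k Q [set v | B k (v k)])%E.
Variable G : {set I}.
Hypothesis gaussQ : forall k (B : set (measurableTypeR R)), k \in G ->
  measurable B -> Q [set v | B (v k)] = normal_prob 0 1 B.
Implicit Types M N : I -> R.

(** The geometric mean of two Gaussian densities of equal covariance is the density at the midpoint,
    damped by exp (- |M - N|^2 / 8). *)
Lemma sqrt_tiltM M N v : Num.sqrt (tilt M v * tilt N v) =
  expR (- (\sum_k (M k - N k) ^+ 2) / 8) * tilt (fun k => (M k + N k) / 2) v.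
Proof.
pose h k := (M k + N k) / 2; rewrite -/h.
have hh : (fun k => h k + h k) = (fun k => M k + N k).
  by apply/funext => k; rewrite /h; field.
have -> : tilt M v * tilt N v =
    (expR (- (\sum_k (M k - N k) ^+ 2) / 8) * tilt h v) ^+ 2.
  rewrite exprMn [tilt h v ^+ 2]expr2 (tiltM h h) hh (tiltM M N) mulrCA;
    congr (_ * _).
  rewrite expr2 -!expRD; congr expR.
  have -> : \sum_k h k * h k =
      \sum_k M k * N k + (\sum_k (M k - N k) ^+ 2) / 4.
    by rewrite mulr_suml -big_split/=; apply: eq_bigr => k _; rewrite /h; field.
  by field.
by rewrite sqrtr_sqr ger0_norm// mulr_ge0 ?expR_ge0 ?tilt_ge0.
Qed.

Lemma integral_tiltM M N :
  (forall k, k \notin G -> M k = 0) -> (forall k, k \notin G -> N k = 0) ->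
  (\int[Q]_v (tilt M v * tilt N v)%:E = (expR (\sum_k M k * N k))%:E)%E.
Proof.
move=> MG NG.
under eq_integral do rewrite tiltM mulrC.
rewrite ge0_integral_scaler ?expR_ge0//.
- rewrite (integral_tilt indepQ gaussQ) ?mule1// => k kG.
  by rewrite MG// NG// addr0.
- by move=> v; exact: tilt_ge0.
- exact: measurable_tilt.
Qed.

Lemma integral_sqrt_tiltM M N :
  (forall k, k \notin G -> M k = 0) -> (forall k, k \notin G -> N k = 0) ->
  (\int[Q]_v (Num.sqrt (tilt M v * tilt N v))%:E =
   (expR (- (\sum_k (M k - N k) ^+ 2) / 8))%:E)%E.
Proof.
move=> MG NG.
under eq_integral do rewrite sqrt_tiltM.
rewrite ge0_integral_scaler ?expR_ge0//.
- rewrite (integral_tilt indepQ gaussQ) ?mule1// => k kG.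
  by rewrite MG// NG// addr0 mul0r.
- by move=> v; exact: tilt_ge0.
- exact: measurable_tilt.
Qed.

End tilt_products.

Section mixture_affinity.
Context {R : realType} {I : finType} (Q : probability (coord_space R I) R).
Hypothesis indepQ : forall B : I -> set (measurableTypeR R),
  (forall k, measurable (B k)) ->
  Q [set v | forall k, B k (v k)] = (\prod_k Q [set v | B k (v k)])%E.
Variable G : {set I}.
Hypothesis gaussQ : forall k (B : set (measurableTypeR R)), k \in G ->
  measurable B -> Q [set v | B (v k)] = normal_prob 0 1 B.
Variables (eps : R) (M N : I -> R).
Hypotheses (MG : forall k, k \notin G -> M k = 0)
           (NG : forall k, k \notin G -> N k = 0).
Local Notation V := (coord_space R I).

(* Likelihood ratio, against pure noise, of noise shifted by M with probability
   eps and unshifted otherwise. *)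
Definition mixture (M : I -> R) (v : V) := (1 - eps) + eps * tilt M v.

(** The Hellinger affinity; the integral of (sqrt f - sqrt g)^2 is 2 (1 - affinity). Taking [fine]
    loses nothing, as AM-GM bounds the integral by 1. *)
Definition mixture_affinity : R :=
  fine (\int[Q]_v (Num.sqrt (mixture M v * mixture N v))%:E)%E.

Lemma measurable_mixture (M' : I -> R) : measurable_fun setT (mixture M').
Proof.
apply: measurable_funD => //; apply: measurable_funM => //.
exact: measurable_tilt.
Qed.

Hypothesis eps01 : 0 <= eps <= 1.

Lemma mixture_ge0 (M' : I -> R) v : 0 <= mixture M' v.
Proof.
have /andP[e0 e1] := eps01.
by rewrite addr_ge0 ?subr_ge0// mulr_ge0// tilt_ge0.
Qed.

Lemma integral_mixture (M' : I -> R) : (forall k, k \notin G -> M' k = 0) ->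
  (\int[Q]_v (mixture M' v)%:E = 1)%E.
Proof.
have /andP[e0 e1] := eps01 => M'G.
rewrite ge0_integral_addr ?subr_ge0//.
- rewrite integral_constr ge0_integral_scaler//.
  + by rewrite (integral_tilt indepQ gaussQ)// mule1 -EFinD subrK.
  + by move=> v; exact: tilt_ge0.
  + exact: measurable_tilt.
- by move=> v; rewrite mulr_ge0// tilt_ge0.
- by apply: measurable_funM => //; exact: measurable_tilt.
Qed.

Let measurable_sqrtMM :
  measurable_fun setT (fun v => Num.sqrt (mixture M v * mixture N v)).
Proof.
by apply/measurable_sqrtr/measurable_funM; exact: measurable_mixture.
Qed.

Let sqrtMM_ge0 v : 0 <= Num.sqrt (mixture M v * mixture N v).
Proof. exact: sqrtr_ge0. Qed.

Let integral_sqrtMM_le1 :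
  (\int[Q]_v (Num.sqrt (mixture M v * mixture N v))%:E <= 1)%E.
Proof.
apply: (@le_trans _ _ (\int[Q]_v (1 / 2 * (mixture M v + mixture N v))%:E)%E).
  apply: ge0_le_integralr => //.
    by apply: measurable_funM => //; apply: measurable_funD;
      exact: measurable_mixture.
  move=> v; have := mixture_ge0 M v; have := mixture_ge0 N v.
  move: (mixture M v) (mixture N v) => a b b0 a0.
  rewrite sqrtrM// -[X in _ <= _ * (X + _)](sqr_sqrtr a0).
  rewrite -[X in _ <= _ * (_ + X)](sqr_sqrtr b0).
  rewrite -subr_ge0; set x := Num.sqrt a; set y := Num.sqrt b.
  have -> : 1 / 2 * (x ^+ 2 + y ^+ 2) - x * y = (x - y) ^+ 2 / 2 by field.
  by rewrite divr_ge0 ?sqr_ge0.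
rewrite ge0_integral_scaler//.
- rewrite ge0_integral_addr ?integral_mixture//.
  + by rewrite -EFinD -EFinM lee_fin; lra.
  + by move=> v; exact: mixture_ge0.
  + by move=> v; exact: mixture_ge0.
  + exact: measurable_mixture.
  + exact: measurable_mixture.
- by move=> v; rewrite addr_ge0 ?mixture_ge0.
- by apply: measurable_funD; exact: measurable_mixture.
Qed.

Lemma mixture_affinityE :
  (\int[Q]_v (Num.sqrt (mixture M v * mixture N v))%:E = mixture_affinity%:E)%E.
Proof.
rewrite /mixture_affinity fineK// ge0_fin_numE.
  exact: le_lt_trans integral_sqrtMM_le1 (ltry _).
by apply: integral_ge0 => v _; rewrite lee_fin.
Qed.

Lemma mixture_affinity01 : 0 <= mixture_affinity <= 1.
Proof.
rewrite -!lee_fin -mixture_affinityE integral_sqrtMM_le1 andbT.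
by apply: integral_ge0 => v _; rewrite lee_fin.
Qed.

(** Integrating [sqrt_mixture_ge] leaves the affinity exp (- |M - N|^2 / 8) of the two pure shifts,
    which is at least 1 - |M - N|^2 / 8. *)
Lemma mixture_affinity_ge_sparse :
  1 - eps * (\sum_k (M k - N k) ^+ 2) / 8 <= mixture_affinity.
Proof.
have /andP[e0 e1] := eps01.
rewrite -lee_fin -mixture_affinityE.
have msq : measurable_fun setT (fun v : V => Num.sqrt (tilt M v * tilt N v)).
  by apply/measurable_sqrtr/measurable_funM; exact: measurable_tilt.
apply: (@le_trans _ _
  (\int[Q]_v (1 - eps + eps * Num.sqrt (tilt M v * tilt N v))%:E)%E).
  rewrite ge0_integral_addr//; last 3 first.
  - by move=> v; rewrite subr_ge0.
  - by move=> v; rewrite mulr_ge0 ?sqrtr_ge0.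
  - exact: measurable_funM.
  rewrite integral_constr ge0_integral_scaler//.
  rewrite (integral_sqrt_tiltM indepQ gaussQ)// -EFinM -EFinD lee_fin.
  have := expR_ge1Dx (- (\sum_k (M k - N k) ^+ 2) / 8).
  set s := \sum_k _; set x := expR _ => sx.
  have : eps * (1 + - s / 8) <= eps * x by rewrite ler_wpM2l.
  by lra.
apply: ge0_le_integralr => //.
- by move=> v; rewrite addr_ge0 ?subr_ge0 ?mulr_ge0 ?sqrtr_ge0.
- by apply: measurable_funD => //; exact: measurable_funM.
- by move=> v; apply: sqrt_mixture_ge => //; exact: tilt_ge0.
Qed.

(** Integrating [mixture_le_sqrt], the square (tilt M - tilt N)^2 has integral 2 exp s (1 - exp (-
    c)), at most 2 c exp s. *)
Lemma mixture_affinity_ge_dense (s c : R) : eps < 1 ->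
  \sum_k M k ^+ 2 = s -> \sum_k N k ^+ 2 = s -> \sum_k M k * N k = s - c ->
  1 - eps ^+ 2 / (4 * (1 - eps)) * (expR s * c) <= mixture_affinity.
Proof.
have /andP[e0 _] := eps01 => e1 Ms Ns MNs.
pose K := eps ^+ 2 / (4 * (1 - eps)).
have K0 : 0 <= K by rewrite divr_ge0 ?sqr_ge0// mulr_ge0// subr_ge0 ltW.
have K20 : 0 <= 2 * K by exact: mulr_ge0.
have mt M' : measurable_fun setT (tilt M' : V -> R) by exact: measurable_tilt.
have t0 M' (v : V) : 0 <= tilt M' v := tilt_ge0 M' v.
(* The cross term of the square is moved to the left, so that only nonnegative functions are
   integrated. *)
pose f v := (mixture M v + mixture N v) + 2 * K * (tilt M v * tilt N v).
pose g v := 2 * Num.sqrt (mixture M v * mixture N v) +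
  K * (tilt M v * tilt M v + tilt N v * tilt N v).
have fg : (\int[Q]_v (f v)%:E <= \int[Q]_v (g v)%:E)%E.
  apply: ge0_le_integralr.
  - move=> v; apply: addr_ge0; first by apply: addr_ge0; exact: mixture_ge0.
    by apply: mulr_ge0; exact: mulr_ge0.
  - apply: measurable_funD.
      by apply: measurable_funD; exact: measurable_mixture.
    by apply: measurable_funM => //; exact: measurable_funM.
  - apply: measurable_funD; first exact: measurable_funM.
    by apply: measurable_funM => //; apply: measurable_funD;
      exact: measurable_funM.
  - move=> v; have := @mixture_le_sqrt R eps (tilt M v) (tilt N v).
    rewrite e0 e1 -/K => /(_ isT (t0 _ _) (t0 _ _)).
    rewrite -/(mixture M v) -/(mixture N v) /f /g.
    set x := mixture M v; set y := mixture N v; set z := Num.sqrt _.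
    set a := tilt M v; set b := tilt N v => H.
    rewrite -subr_ge0; move: H; rewrite -subr_ge0; congr (_ <= _); ring.
move: fg; rewrite /f ge0_integral_addr; last 4 first.
- by move=> v; rewrite addr_ge0 ?mixture_ge0.
- by move=> v; apply: mulr_ge0; exact: mulr_ge0.
- by apply: measurable_funD; exact: measurable_mixture.
- by apply: measurable_funM => //; exact: measurable_funM.
rewrite ge0_integral_addr; [|exact: mixture_ge0|exact: mixture_ge0
  |exact: measurable_mixture|exact: measurable_mixture].
rewrite !integral_mixture// ge0_integral_scaler//; last 2 first.
- by move=> v; exact: mulr_ge0.
- exact: measurable_funM.
rewrite /g ge0_integral_addr; last 4 first.
- by move=> v; exact: mulr_ge0.
- by move=> v; apply: mulr_ge0 => //; apply: addr_ge0; exact: mulr_ge0.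
- exact: measurable_funM.
- by apply: measurable_funM => //; apply: measurable_funD;
  exact: measurable_funM.
rewrite ge0_integral_scaler// mixture_affinityE ge0_integral_scaler//;
  last 2 first.
- by move=> v; apply: addr_ge0; exact: mulr_ge0.
- by apply: measurable_funD; exact: measurable_funM.
rewrite ge0_integral_addr; last 4 first.
- by move=> v; exact: mulr_ge0.
- by move=> v; exact: mulr_ge0.
- exact: measurable_funM.
- exact: measurable_funM.
rewrite !(integral_tiltM indepQ gaussQ)// -/K.
move=> H2.
have {}H2 : 1 + 1 + 2 * K * expR (\sum_k M k * N k) <= 2 * mixture_affinity +
    K * (expR (\sum_k M k * M k) + expR (\sum_k N k * N k)).
  by rewrite -lee_fin; exact: H2.
move: H2; rewrite MNs.
have -> : \sum_k M k * M k = s.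
  by rewrite -Ms; apply: eq_bigr => k _; rewrite expr2.
have -> : \sum_k N k * N k = s.
  by rewrite -Ns; apply: eq_bigr => k _; rewrite expr2.
have := expR_ge1Dx (- c); rewrite expRD.
have := expR_gt0 s.
set E := expR s; set E' := expR (- c) => E0 E'c.
have H : K * (E * (1 - c)) <= K * (E * E').
  by rewrite ler_wpM2l// ler_wpM2l// ltW.
move=> H2.
have : 1 + 1 + 2 * (K * (E * (1 - c))) <= 2 * mixture_affinity + K * (E + E).
  apply: le_trans H2; rewrite lerD2l -mulrA; rewrite ler_wpM2l//.
rewrite [K * (E * (1 - c))](_ : _ = K * E - K * (E * c)); last by ring.
rewrite [K * (E + E)]mulrDr; set KE := K * E; set KEc := K * (E * c); lra.
Qed.

End mixture_affinity.

(** * Testing between two product mixtures *)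

Section two_point_bound.
Context {R : realType} {I : finType} (Q : probability (coord_space R I) R).
Hypothesis indepQ : forall B : I -> set (measurableTypeR R),
  (forall k, measurable (B k)) ->
  Q [set v | forall k, B k (v k)] = (\prod_k Q [set v | B k (v k)])%E.
Variable G : {set I}.
Hypothesis gaussQ : forall k (B : set (measurableTypeR R)), k \in G ->
  measurable B -> Q [set v | B (v k)] = normal_prob 0 1 B.
Variables (eps : R) (J : finType) (S : J -> {set I}).
Hypotheses (eps01 : 0 <= eps <= 1) (SG : forall j, S j \subset G)
  (Sdisj : forall j j' k, j != j' -> k \in S j -> k \notin S j').
Local Notation V := (coord_space R I).
Implicit Types M N : J -> I -> R.

Definition product_mixture M (v : V) := \prod_j mixture eps (M j) v.

Lemma product_mixture_ge0 M v : 0 <= product_mixture M v.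
Proof. by apply: prodr_ge0 => j _; exact: mixture_ge0. Qed.

Lemma measurable_product_mixture M : measurable_fun setT (product_mixture M).
Proof. by apply: measurable_prod => j _; exact: measurable_mixture. Qed.

Let off_G M : (forall j k, k \notin S j -> M j k = 0) ->
  forall j k, k \notin G -> M j k = 0.
Proof.
by move=> MS j k kG; apply: MS; apply: contra kG;
  exact: (fintype.subsetP (SG j)).
Qed.

Let depends_on_mixture M j : (forall j k, k \notin S j -> M j k = 0) ->
  depends_on (S j) (mixture eps (M j)).
Proof. by move=> MS v; rewrite /mixture depends_on_tilt//; exact: MS. Qed.

Lemma integral_product_mixture M : (forall j k, k \notin S j -> M j k = 0) ->
  (\int[Q]_v (product_mixture M v)%:E = 1)%E.
Proof.
move=> MS; rewrite (integral_prod_indep indepQ (S := S) (c := fun=> 1)).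
- by rewrite big1.
- exact: index_enum_uniq.
- exact: Sdisj.
- by move=> j; exact: depends_on_mixture.
- by move=> j; exact: measurable_mixture.
- by move=> j v; exact: mixture_ge0.
- by move=> j; apply: (integral_mixture indepQ gaussQ) => //; exact: off_G.
Qed.

(** The left side is the sum of the two success probabilities of the test [H]. The selected density
    is at most the maximum of both, [maxr_le_hellinger] bounds that maximum, and independence of the
    columns makes the total affinity the product [rho]. The weight [lam] stays free: a large one
    shrinks 1 / lam at the cost of the Hellinger term. *)
Lemma two_point_bound M N (H : V -> bool) (delta lam : R) :
  (forall j k, k \notin S j -> M j k = 0) ->
  (forall j k, k \notin S j -> N j k = 0) ->
  (forall j, 1 - delta <= mixture_affinity Q eps (M j) (N j)) ->
  0 < lam -> measurable_fun setT H ->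
  (\int[Q]_v (if H v then product_mixture M v else product_mixture N v)%:E <=
   (1 + lam / 2 * (#|J|%:R * delta) + 1 / lam)%:E)%E.
Proof.
move=> MS NS aff lam0 mH.
have mM := measurable_product_mixture M.
have mN := measurable_product_mixture N.
have M0 v := product_mixture_ge0 M v; have N0 v := product_mixture_ge0 N v.
pose rho := \prod_j mixture_affinity Q eps (M j) (N j).
pose root v := Num.sqrt (product_mixture M v * product_mixture N v).
have mroot : measurable_fun setT root by apply/measurable_sqrtr/measurable_funM.
have root0 v : 0 <= root v := sqrtr_ge0 _.
have rootE : (\int[Q]_v (root v)%:E = rho%:E)%E.
  transitivity (\int[Q]_v
    (\prod_j Num.sqrt (mixture eps (M j) v * mixture eps (N j) v))%:E)%E.
    apply: eq_integral => v _; congr (_%:E).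
    rewrite /root -big_split/=.
    elim: (index_enum J) => [|j s IH]; first by rewrite !big_nil sqrtr1.
    by rewrite !big_cons sqrtrM ?IH// mulr_ge0// mixture_ge0.
  apply: (integral_prod_indep indepQ (S := S)).
  - exact: index_enum_uniq.
  - exact: Sdisj.
  - by move=> j v; rewrite !depends_on_mixture.
  - by move=> j; apply/measurable_sqrtr/measurable_funM;
    exact: measurable_mixture.
  - by move=> j v; exact: sqrtr_ge0.
  - by move=> j; apply: (mixture_affinityE indepQ gaussQ) => //; exact: off_G.
have rho_ge : 1 - rho <= #|J|%:R * delta.
  rewrite cardT enumT; apply: one_minus_prod_le => // j.
  by apply: (mixture_affinity01 indepQ gaussQ) => //; exact: off_G.
pose f v := if H v then product_mixture M v else product_mixture N v.
have f0 v : 0 <= f v by rewrite /f; case: ifP.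
have mf : measurable_fun setT f by exact: measurable_fun_ifT.
pose C := 1 / 2 + lam / 4 + 1 / (2 * lam).
have C0 : 0 <= C by rewrite /C !addr_ge0 ?divr_ge0 ?mulr_ge0 ?ltW.
have lam20 : 0 <= lam / 2 by rewrite divr_ge0// ltW.
have : (\int[Q]_v (f v + lam / 2 * root v)%:E <=
    \int[Q]_v (C * (product_mixture M v + product_mixture N v))%:E)%E.
  apply: ge0_le_integralr.
  - by move=> v; apply: addr_ge0 => //; exact: mulr_ge0.
  - by apply: measurable_funD => //; exact: measurable_funM.
  - by apply: measurable_funM => //; exact: measurable_funD.
  - move=> v; apply: le_trans (maxr_le_hellinger lam0 (M0 v) (N0 v)).
    by rewrite lerD2r /f le_max; case: ifP; rewrite lexx ?orbT.
rewrite ge0_integral_addr//; last 2 first.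
- by move=> v; exact: mulr_ge0.
- exact: measurable_funM.
rewrite ge0_integral_scaler// rootE.
rewrite ge0_integral_scaler//; last 2 first.
- by move=> v; exact: addr_ge0.
- exact: measurable_funD.
rewrite ge0_integral_addr// !integral_product_mixture//.
rewrite -/f => le.
have {le} : (\int[Q]_v (f v)%:E + (lam / 2 * rho)%:E <= (C * (1 + 1))%:E)%E.
  by exact: le.
rewrite -leeBrDr// -EFinB => /le_trans; apply; rewrite lee_fin.
have := ler_wpM2l lam20 rho_ge.
set D := #|J|%:R * delta; rewrite mulrBr mulr1 => H1.
have -> : C * (1 + 1) = 1 + lam / 2 + 1 / lam.
  by rewrite /C; field; rewrite gt_eqF.
by move: H1; set x := lam / 2 * rho; set y := lam / 2 * D; lra.
Qed.

End two_point_bound.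

(** * The ARW model *)

Section arw_coordinates.
Context {R : realType} {n p : nat}.
Definition arw_index : finType := ('I_n + 'I_p + 'I_n * 'I_p)%type.
Local Notation V := (coord_space R arw_index).

Definition noise_mx (v : V) : 'M[R]_(n, p) := \matrix_(i, j) v (inr (i, j)).

Definition observed_mx (v : V) : 'M[R]_(n, p) :=
  \matrix_(i, j) (v (inl (inl i)) * v (inl (inr j)) + v (inr (i, j))).

Lemma measurable_into_mx (d : measure_display) (T : measurableType d)
    (f : T -> g_sigma_algebraType (@mx_cylinders R n p)) :
  (forall i j, measurable_fun setT (fun t => f t i j : measurableTypeR R)) ->
  measurable_fun setT f.
Proof.
move=> mf.
apply: (@measurability _ _ T (g_sigma_algebraType (@mx_cylinders R n p))
  setT f (@mx_cylinders R n p) erefl).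
by move=> _ [_ [i [j [B [mB ->]]]] <-]; exact: mf.
Qed.

Lemma measurable_noise_mx :
  measurable_fun setT
    (noise_mx : V -> g_sigma_algebraType (@mx_cylinders R n p)).
Proof.
apply: measurable_into_mx => i j.
have -> : (fun v : V => noise_mx v i j) = (fun v => v (inr (i, j))).
  by apply/funext => v; rewrite mxE.
exact: measurable_coord.
Qed.

Lemma measurable_observed_mx :
  measurable_fun setT
    (observed_mx : V -> g_sigma_algebraType (@mx_cylinders R n p)).
Proof.
apply: measurable_into_mx => i j.
have -> : (fun v : V => observed_mx v i j) =
    (fun v => v (inl (inl i)) * v (inl (inr j)) + v (inr (i, j))).
  by apply/funext => v; rewrite mxE.
by apply: measurable_funD; [apply: measurable_funM|]; exact: measurable_coord.
Qed.

Definition noise_set : {set arw_index} :=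
  [set k | if k is inr _ then true else false].

Definition column_set (j : 'I_p) : {set arw_index} :=
  [set k | if k is inr ij then ij.2 == j else false].

Lemma column_set_sub j : column_set j \subset noise_set.
Proof. by apply/fintype.subsetP => -[[?|?]|?]; rewrite !inE. Qed.

Lemma column_set_disjoint j j' k :
  j != j' -> k \in column_set j -> k \notin column_set j'.
Proof. by move: k => [[?|?]|?]; rewrite !inE// => jj' /eqP ->. Qed.

Variable tau : R.

(** The shift of column [j] alone when [mu] is [tau] there, extended by 0 to all coordinates so that
    every column is handled on the same space. *)
Definition column_mean (l : {ffun 'I_n -> bool}) (j : 'I_p)
    (k : arw_index) : R :=
  if k is inr ij then
    if ij.2 == j then tau * label_val R (l ij.1) else 0
  else 0.

Lemma column_mean_off l j k : k \notin column_set j -> column_mean l j k = 0.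
Proof.
by move: k => [[?|?]|ij]//; rewrite inE /column_mean => /negbTE ->.
Qed.

(** Serves squares and inner products alike; [F 0 0 = 0] removes everything outside column [j]. *)
Lemma sum_column_mean (F : R -> R -> R) l l' j : F 0 0 = 0 ->
  \sum_k F (column_mean l j k) (column_mean l' j k) =
  \sum_i F (tau * label_val R (l i)) (tau * label_val R (l' i)).
Proof.
move=> F0; rewrite big_sumType/= big1 ?add0r; last by case.
rewrite -(pair_bigA _ (fun i j' =>
  F (if j' == j then tau * label_val R (l i) else 0)
  (if j' == j then tau * label_val R (l' i) else 0)))/=.
apply: eq_bigr => i _; rewrite (bigD1 j)//= eqxx big1 ?addr0// => j' /negbTE ->.
exact: F0.
Qed.

Definition arw_mean (l : {ffun 'I_n -> bool}) (s : {ffun 'I_p -> bool})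
    (k : arw_index) : R :=
  if k is inr ij then label_val R (l ij.1) * (if s ij.2 then tau else 0)
  else 0.

Lemma tilt_arw_mean l s (v : V) :
  tilt (arw_mean l s) v = \prod_j (if s j then tilt (column_mean l j) v else 1).
Proof.
transitivity (\prod_j \prod_k (if s j then
    expR (column_mean l j k * v k - column_mean l j k ^+ 2 / 2) else 1));
      last first.
  by apply: eq_bigr => j _; case: (s j) => //; rewrite big1.
have exp0 (x : R) : expR (0 * x - 0 ^+ 2 / 2) = 1.
  by rewrite mul0r expr0n mul0r subr0 expR0.
rewrite exchange_big; apply: eq_bigr => k _.
move: k => [[i|j]|[i j]]/=.
- by rewrite exp0 big1// => j _; rewrite if_same.
- by rewrite exp0 big1// => j' _; rewrite if_same.
rewrite (bigD1 j)//= eqxx big1 ?mulr1; last first.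
  by move=> j' /negbTE jj'; rewrite eq_sym jj' exp0 if_same.
case: (s j); first by rewrite [tau * _]mulrC.
by rewrite mulr0 exp0.
Qed.

Variable eps : R.

Definition support_weight (s : {ffun 'I_p -> bool}) : R :=
  \prod_j (if s j then eps else 1 - eps).

(** Distributivity: a sum over 2^p supports of products over columns is a product of p two-term
    sums. This is where independence of the entries of [mu] yields the product density F_l. *)
Lemma sum_tilt_arw_mean l (v : V) :
  \sum_s support_weight s * tilt (arw_mean l s) v =
  product_mixture eps (column_mean l) v.
Proof.
rewrite /product_mixture.
under [RHS]eq_bigr => j _.
  rewrite (_ : mixture _ _ _ = \sum_b (if b then eps else 1 - eps) *
    (if b then tilt (column_mean l j) v else 1)); last first.
    by rewrite big_bool/= mulr1 addrC.
  over.
rewrite bigA_distr_bigA/=; apply: eq_bigr => s _.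
by rewrite tilt_arw_mean -big_split.
Qed.

End arw_coordinates.

Definition flip_label (n : nat) (i0 : 'I_n) (l : {ffun 'I_n -> bool}) :
    {ffun 'I_n -> bool} :=
  [ffun i => if i == i0 then ~~ l i else l i].

Lemma flip_labelK (n : nat) (i0 : 'I_n) : involutive (flip_label i0).
Proof.
by move=> l; apply/ffunP => i; rewrite !ffunE; case: (i == i0); rewrite ?negbK.
Qed.

Lemma label_val_sqr (R : realType) b : label_val R b ^+ 2 = 1.
Proof. by case: b; rewrite /label_val ?sqrrN expr1n. Qed.

Lemma label_valN (R : realType) b : label_val R (~~ b) = - label_val R b.
Proof. by case: b; rewrite /label_val ?opprK. Qed.

Lemma label_val_inj (R : realType) : injective (label_val R).
Proof.
have neq : (1 == -1 :> R) = false by apply/negbTE; rewrite gt_eqF//; lra.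
by move=> [] []//= /eqP; rewrite /label_val ?neq// eq_sym neq.
Qed.

Section flip_moments.
Context {R : realType} {n p : nat} (tau : R) (i0 : 'I_n)
  (l : {ffun 'I_n -> bool}) (j : 'I_p).
Local Notation M := (column_mean tau l j).
Local Notation N := (column_mean tau (flip_label i0 l) j).

Lemma sum_column_mean_sqr (l' : {ffun 'I_n -> bool}) :
  \sum_k column_mean tau l' j k ^+ 2 = n%:R * tau ^+ 2.
Proof.
rewrite (sum_column_mean tau (F := fun x _ => x ^+ 2) l' l')/=;
  last by rewrite expr0n.
under eq_bigr do rewrite exprMn label_val_sqr mulr1.
by rewrite sumr_const card_ord mulr_natl.
Qed.

(** n - 1 labels agree and one is opposite, hence (n - 1) tau^2 - tau^2. The deficit 2 tau^2 is the
    [c] of the chi-square bound. *)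
Lemma sum_column_meanM_flip :
  \sum_k M k * N k = n%:R * tau ^+ 2 - 2 * tau ^+ 2.
Proof.
rewrite (sum_column_mean tau (F := fun x y => x * y))/=; last by rewrite mulr0.
have -> : n%:R * tau ^+ 2 = \sum_(i < n) tau ^+ 2.
  by rewrite sumr_const card_ord mulr_natl.
rewrite (bigD1 i0)//= [in RHS](bigD1 i0)//= ffunE eqxx label_valN.
have -> : tau * label_val R (l i0) * (tau * - label_val R (l i0)) =
  - (tau ^+ 2 * label_val R (l i0) ^+ 2) by ring.
rewrite label_val_sqr (eq_bigr (fun=> tau ^+ 2)); last first.
  move=> i /negbTE ii0; rewrite ffunE ii0.
  have -> : tau * label_val R (l i) * (tau * label_val R (l i)) =
    tau ^+ 2 * label_val R (l i) ^+ 2 by ring.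
  by rewrite label_val_sqr mulr1.
by ring.
Qed.

Lemma sum_column_mean_sub_flip : \sum_k (M k - N k) ^+ 2 = 4 * tau ^+ 2.
Proof.
transitivity (\sum_k M k ^+ 2 + \sum_k N k ^+ 2 - 2 * \sum_k M k * N k).
  rewrite mulr_sumr -big_split -sumrB/=; apply: eq_bigr => k _; ring.
by rewrite !sum_column_mean_sqr sum_column_meanM_flip; ring.
Qed.

End flip_moments.

(** * Success probability for one label *)

Section arw_on_coordinates.
Context {R : realType} {n p : nat}.
Local Notation I := (@arw_index n p).
Local Notation V := (coord_space R I).
Context (Q : probability V R).
Hypothesis indepQ : forall B : I -> set (measurableTypeR R),
  (forall k, measurable (B k)) ->
  Q [set v | forall k, B k (v k)] = (\prod_k Q [set v | B k (v k)])%E.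
Hypothesis gaussQ : forall (k : I) (B : set (measurableTypeR R)),
  k \in noise_set -> measurable B ->
  Q [set v | B (v k)] = normal_prob 0 1 B.
Variables (eps tau : R).
Hypothesis labelQ : forall i b,
  Q [set v : V | v (inl (inl i)) = label_val R b] = (2^-1)%:E.
Hypothesis muQ : forall j (b : bool),
  Q [set v : V | v (inl (inr j)) = if b then tau else 0] =
  (if b then eps else 1 - eps)%:E.
Hypotheses (eps01 : 0 <= eps <= 1) (tau0 : tau != 0).
Variables (h : 'M[R]_(n, p) -> bool) (i0 : 'I_n).
Hypothesis mh : measurable_fun setT
  (h : g_sigma_algebraType (@mx_cylinders R n p) -> bool).

(** The noise sides are left free, so that translating the noise preserves every cell. *)
Definition cell_side (l : {ffun 'I_n -> bool}) (s : {ffun 'I_p -> bool})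
    (k : I) : set (measurableTypeR R) :=
  match k with
  | inl (inl i) => [set label_val R (l i)]
  | inl (inr j) => [set (if s j then tau else 0)]
  | inr _ => setT
  end.

Definition cell l s : set V := [set v | forall k, cell_side l s k (v k)].

Let measurable_cell_side l s k : measurable (cell_side l s k).
Proof.
by move: k => [[i|j]|ij]//=; exact: (measurable_set1 (_ : R)).
Qed.

Let measurable_cell l s : measurable (cell l s).
Proof. by apply: rectangles_measurable; exists (cell_side l s); split. Qed.

Lemma cell_prob l s : Q (cell l s) = ((2^-1) ^+ n * support_weight eps s)%:E.
Proof.
rewrite /cell indepQ; last exact: measurable_cell_side.
rewrite big_sumType/= big_sumType/= [X in (_ * X)%E]big1 ?mule1; last first.
  by move=> ij _; exact: probability_setT.
rewrite (eq_bigr (fun=> (2^-1)%:E)); last by move=> i _; exact: labelQ.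
rewrite prodEFin prodr_const card_ord EFinM; congr (_ * _)%E.
rewrite (eq_bigr (fun j => (if s j then eps else 1 - eps)%:E)).
  by rewrite prodEFin.
by move=> j _; exact: muQ.
Qed.

Definition correct : set V :=
  [set v | label_val R (h (observed_mx v)) = v (inl (inl i0))].

Let label_set_measurable (c : R) :
  measurable ([set c] : set (measurableTypeR R)).
Proof. exact: (measurable_set1 c). Qed.

Let measurable_h_observed :
  measurable_fun setT (fun v : V => h (observed_mx v)).
Proof. exact: measurableT_comp mh measurable_observed_mx. Qed.

Let measurable_h_noise : measurable_fun setT (fun v : V => h (noise_mx v)).
Proof. exact: measurableT_comp mh measurable_noise_mx. Qed.

Lemma measurable_correct : measurable correct.
Proof.
have -> : correct = \bigcup_(b in [set: bool])
    ((fun v : V => h (observed_mx v)) @^-1` [set b] `&`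
     [set v : V | [set label_val R b] (v (inl (inl i0)))]).
  apply/seteqP; split=> v /=; last by move=> [b _ [/= hb vb]];
    rewrite /correct/= hb vb.
  by move=> hv; exists (h (observed_mx v)).
apply: fin_bigcup_measurable => //= b _; apply: measurableI.
  by rewrite -[X in measurable X]setTI; exact: measurable_h_observed.
exact: (measurable_coord_preimage _ (label_set_measurable (label_val R b))).
Qed.

Let measurable_hit b :
  measurable_fun setT (fun v : V => (h (noise_mx v) == b)%:R : R).
Proof.
have -> : (fun v : V => (h (noise_mx v) == b)%:R : R) =
    \1_((fun v : V => h (noise_mx v)) @^-1` [set b]).
  apply/funext => v; rewrite indicE; congr (_%:R); congr nat_of_bool.
  by apply/eqP/idP; rewrite inE.
apply: measurable_indic; rewrite -[X in measurable X]setTI.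
exact: measurable_h_noise.
Qed.

Lemma arw_mean_off (l : {ffun 'I_n -> bool}) (s : {ffun 'I_p -> bool})
    (k : I) :
  k \notin noise_set -> arw_mean tau l s k = 0.
Proof. by move: k => [[?|?]|?]//; rewrite inE. Qed.

Lemma cell_translate l s (v : V) :
  cell l s (translate (arw_mean tau l s) v) = cell l s v.
Proof.
apply/propext; rewrite /cell/=; split=> cv k; have := cv k;
  by move: k => [[i|j]|ij] /=; rewrite /translate/= ?addr0.
Qed.

Lemma noise_mx_translate l s (v : V) : cell l s v ->
  noise_mx (translate (arw_mean tau l s) v) = observed_mx v.
Proof.
move=> cv; apply/matrixP => i j; rewrite !mxE /translate/= addrC.
by have /= -> := cv (inl (inl i)); have /= -> := cv (inl (inr j)).
Qed.

(** The integral is the probability of guessing [l i0] when labels and support are [l] and [s],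
    expressed under pure noise. *)
Lemma correct_cell_prob l s :
  Q (correct `&` cell l s) = (((2^-1) ^+ n * support_weight eps s)%:E *
    (\int[Q]_v ((h (noise_mx v) == l i0)%:R * tilt (arw_mean tau l s) v)%:E))%E.
Proof.
pose A : set V := cell l s `&` [set v | h (noise_mx v) = l i0].
have mA : measurable A.
  apply: measurableI => //.
  rewrite -[X in measurable X]setTI.
  exact: (measurable_h_noise _ (Y := [set l i0])).
(* On the cell the observation is the noise translated by the known mean, so correctness becomes a
   condition on translated noise. *)
have -> : correct `&` cell l s = translate (arw_mean tau l s) @^-1` A.
  apply/seteqP; split=> v; rewrite /A/= cell_translate.
    move=> [lv cv]; split=> //; rewrite noise_mx_translate//.
    by apply: (@label_val_inj R); rewrite lv; exact: (cv (inl (inl i0))).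
  move=> [cv]; rewrite noise_mx_translate// => lv; split=> //.
  by rewrite /correct/= lv; apply/esym; exact: (cv (inl (inl i0))).
rewrite (cameron_martin indepQ gaussQ (@arw_mean_off l s) mA) integral_mkcond.
have mcell : measurable_fun setT (\1_(cell l s) : V -> R).
  exact: measurable_indic.
have mtilt : measurable_fun setT (fun v : V => (h (noise_mx v) == l i0)%:R *
  tilt (arw_mean tau l s) v).
  by apply: measurable_funM => //; exact: measurable_tilt.
have intcell : (\int[Q]_v (\1_(cell l s) v)%:E = Q (cell l s))%E.
  by rewrite integral_indic// setIT.
rewrite -(cell_prob l s) -intcell.
(* The cell involves only labels and means, the tilted guess only noise, so the integral over [A]
   factors. *)
rewrite -(integral_mul_indep indepQ
  (S := (~: noise_set)%SET) (S' := noise_set))//.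
- apply: eq_integral => v _; rewrite patchE indicE.
  have -> : (v \in A) = (v \in cell l s) && (h (noise_mx v) == l i0).
    by apply/idP/andP; rewrite !inE; [move=> [? /eqP]|move=> [? /eqP]; split].
  by case: (v \in cell l s); case: (_ == _); rewrite ?mul1r ?mul0r.
- by move=> k; rewrite inE.
- move=> v; rewrite !indicE; congr (_%:R); congr nat_of_bool.
  apply/idP/idP; rewrite !inE => cv k; have := cv k;
    by move: k => [[i|j]|ij] /=; rewrite /restr/= ?inE.
- move=> v; rewrite depends_on_tilt; last exact: arw_mean_off.
  congr ((h _ == _)%:R * _).
  by apply/matrixP => i j; rewrite !mxE /restr inE.
- by move=> v; rewrite mulr_ge0// tilt_ge0.
Qed.

(** In the coordinate space labels and means are arbitrary reals, so the cells do not cover it.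
    These sides describe the union of the cells, whose complement is null. *)
Definition good_side (k : I) : set (measurableTypeR R) :=
  match k with
  | inl (inl i) => [set label_val R true] `|` [set label_val R false]
  | inl (inr j) => [set tau] `|` [set 0]
  | inr _ => setT
  end.

Let measurable_good_side k : measurable (good_side k).
Proof.
by move: k => [[i|j]|ij]//=; apply: measurableU; exact: label_set_measurable.
Qed.

Let prob_two_values (k : I) (a b : R) (x y : R) : a != b -> x + y = 1 ->
  Q [set v | v k = a] = x%:E -> Q [set v | v k = b] = y%:E ->
  Q [set v | ([set a] `|` [set b]) (v k)] = 1%E.
Proof.
move=> ab xy Qa Qb.
have -> : [set v : V | ([set a] `|` [set b]) (v k)] =
    [set v | [set a] (v k)] `|` [set v | [set b] (v k)] by [].
rewrite measureU.
- by transitivity (x%:E + y%:E)%E; [congr (_ + _)%E|rewrite -EFinD xy].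
- exact: (measurable_coord_preimage k (label_set_measurable a)).
- exact: (measurable_coord_preimage k (label_set_measurable b)).
- by apply/seteqP; split=> v //= [-> /eqP]; rewrite (negbTE ab).
Qed.

Lemma good_prob : Q [set v : V | forall k, good_side k (v k)] = 1%E.
Proof.
rewrite indepQ// big1// => -[[i|j]|ij] _.
- apply: (@prob_two_values (inl (inl i)) (label_val R true) (label_val R false)
  2^-1 2^-1) => //.
  + by apply/eqP => /(@label_val_inj R).
  + by field.
- apply: (@prob_two_values (inl (inr j)) tau 0 eps (1 - eps)) => //.
  + by ring.
  + exact: (muQ j true).
  + exact: (muQ j false).
- exact: probability_setT.
Qed.

Lemma correct_prob_le_sum :
  (Q correct <= \sum_l \sum_s Q (correct `&` cell l s))%E.
Proof.
pose good := [set v : V | forall k, good_side k (v k)].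
have mgood : measurable good by apply: rectangles_measurable; exists good_side.
have mcc l s : measurable (correct `&` cell l s).
  by apply: measurableI => //; exact: measurable_correct.
have sub_bigU (J : finType) (F : J -> set V) : (forall j, measurable (F j)) ->
    (Q (\big[setU/set0]_j F j) <= \sum_j Q (F j))%E.
  move=> mF; elim: (index_enum J) => [|j js IH];
    first by rewrite !big_nil measure0.
  rewrite !big_cons; apply: (le_trans (measureU2 _ _ _)) => //.
    exact: bigsetU_measurable.
  exact: leeD.
have mbig l : measurable (\big[setU/set0]_s (correct `&` cell l s)).
  exact: bigsetU_measurable.
apply: (@le_trans _ _
  (Q (\big[setU/set0]_l \big[setU/set0]_s (correct `&` cell l s)))); last first.
  apply: (le_trans (sub_bigU _ _ mbig)); apply: lee_sum => l _.
  exact: sub_bigU.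
set U := \big[setU/set0]_l _.
have mU : measurable U by exact: bigsetU_measurable.
have cU : correct `<=` U `|` ~` good.
  move=> v cv; have [gv|] := pselect (good v); last by right.
  left; rewrite /U.
  pose l := [ffun i => v (inl (inl i)) == label_val R true].
  pose s := [ffun j => v (inl (inr j)) == tau].
  rewrite (bigD1 l)//=; left; rewrite (bigD1 s)//=; left; split=> //.
  move=> [[i|j]|ij]//=.
    rewrite /l ffunE; have := gv (inl (inl i)); case: eqP => [->//|ne] /=.
    by case.
  by rewrite /s ffunE; have := gv (inl (inr j)); case: eqP => [->//|ne] [].
have Qng : Q (~` good) = 0%E.
  by rewrite probability_setC// good_prob subee.
apply: (@le_trans _ _ (Q (U `|` ~` good))).
  apply: le_measure; rewrite ?inE//; first exact: measurable_correct.
  by apply: measurableU => //; exact: measurableC.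
apply: (le_trans (measureU2 _ mU (measurableC mgood))).
by rewrite -[leRHS]adde0; apply: leeD => //; rewrite le_eqVlt; apply/orP;
  left; exact/eqP.
Qed.

Let mixture_part_ge0 (l : {ffun 'I_n -> bool}) (v : V) :
  0 <= (h (noise_mx v) == l i0)%:R * product_mixture eps (column_mean tau l) v.
Proof. by rewrite mulr_ge0// product_mixture_ge0. Qed.

(** The probability of guessing label [i0] correctly given that the labels are [l], with [mu]
    averaged out. *)
Definition hit_mass (l : {ffun 'I_n -> bool}) : \bar R :=
  (\int[Q]_v ((h (noise_mx v) == l i0)%:R *
    product_mixture eps (column_mean tau l) v)%:E)%E.

Lemma support_weight_ge0 (s : {ffun 'I_p -> bool}) : 0 <= support_weight eps s.
Proof.
by apply: prodr_ge0 => j _; have /andP[? ?] := eps01; case: (s j);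
  rewrite ?subr_ge0.
Qed.

Lemma correct_prob_le_hit_mass :
  (Q correct <= ((2^-1) ^+ n)%:E * \sum_l hit_mass l)%E.
Proof.
apply: (le_trans correct_prob_le_sum).
rewrite ge0_sume_distrr; last by move=> l _; apply: integral_ge0 => v _;
  rewrite lee_fin.
apply: lee_sum => l _.
pose t s v : R := (h (noise_mx v) == l i0)%:R * tilt (arw_mean tau l s) v.
have t0 s v : 0 <= t s v by rewrite mulr_ge0// tilt_ge0.
have mt s : measurable_fun setT (t s).
  by apply: measurable_funM => //; exact: measurable_tilt.
have -> : hit_mass l =
    (\sum_s (support_weight eps s)%:E * \int[Q]_v (t s v)%:E)%E.
  transitivity (\int[Q]_v (\sum_s (support_weight eps s * t s v)%:E))%E.
    apply: eq_integral => v _; rewrite -sum_tilt_arw_mean mulr_sumr sumEFin.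
    by congr (_%:E); apply: eq_bigr => s _; rewrite mulrCA.
  rewrite ge0_integral_sum//.
  - apply: eq_bigr => s _; rewrite ge0_integral_scaler//.
    exact: support_weight_ge0.
  - by move=> s; apply/measurable_EFinP; exact: measurable_funM.
  - by move=> s v _; rewrite lee_fin mulr_ge0// support_weight_ge0.
rewrite ge0_sume_distrr; last first.
  move=> s _; apply: mule_ge0; first by rewrite lee_fin support_weight_ge0.
  by apply: integral_ge0 => v _; rewrite lee_fin.
by apply: lee_sum => s _; rewrite correct_cell_prob EFinM muleA.
Qed.

(** A guess that misses [l i0] hits the flipped label, so [hit_mass] at [l] and at its flip add up
    to the integral in [two_point_bound]. *)
Lemma correct_prob_le (delta lam : R) : 0 < lam ->
  (forall l j, 1 - delta <=
    mixture_affinity Q eps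
      (column_mean tau l j) (column_mean tau (flip_label i0 l) j)) ->
  (Q correct <= (1 / 2 * (1 + lam / 2 * (p%:R * delta) + 1 / lam))%:E)%E.
Proof.
move=> lam0 aff; apply: (le_trans correct_prob_le_hit_mass).
have mpm (l : {ffun 'I_n -> bool}) : measurable_fun setT (fun v : V =>
    (h (noise_mx v) == l i0)%:R * product_mixture eps (column_mean tau l) v).
  by apply: measurable_funM => //; exact: measurable_product_mixture.
set B := 1 + lam / 2 * (p%:R * delta) + 1 / lam.
have pair l : (hit_mass l + hit_mass (flip_label i0 l) <= B%:E)%E.
  rewrite /hit_mass -ge0_integral_addr//.
  have mH : measurable_fun setT (fun v : V => h (noise_mx v) == l i0).
    have mb : measurable_fun setT (fun b : bool => b == l i0) by [].
    exact: measurableT_comp mb measurable_h_noise.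
  have := two_point_bound indepQ gaussQ eps01 (S := column_set) column_set_sub
    column_set_disjoint
    (M := column_mean tau l) (N := column_mean tau (flip_label i0 l))
    (H := fun v => h (noise_mx v) == l i0) (@column_mean_off _ _ _ tau l)
    (@column_mean_off _ _ _ tau (flip_label i0 l)) (aff l) lam0 mH.
  rewrite card_ord; apply: le_trans.
  rewrite le_eqVlt; apply/orP; left; apply/eqP; apply: eq_integral => v _.
  rewrite ffunE eqxx; case: (h _); case: (l i0) => /=;
    by rewrite ?mul1r ?mul0r ?addr0 ?add0r.
have hit_ge0 l : (0 <= hit_mass l)%E by apply: integral_ge0 => v _;
  rewrite lee_fin.
have hit_fin l : hit_mass l \is a fin_num.
  rewrite ge0_fin_numE//; apply: le_lt_trans (ltry B); apply: le_trans (pair l).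
  by rewrite leeDl.
pose x l := fine (hit_mass l).
have xE l : hit_mass l = (x l)%:E by rewrite fineK.
rewrite (eq_bigr (fun l => (x l)%:E))// sumEFin -EFinM lee_fin.
have pairx l : x l + x (flip_label i0 l) <= B by rewrite -lee_fin EFinD -!xE.
(* Flipping is a bijection, so the left side counts every label vector twice; this is the source of
   the factor 1 / 2. *)
have : \sum_l (x l + x (flip_label i0 l)) <= \sum_(l : {ffun 'I_n -> bool}) B.
  by apply: ler_sum => l _.
rewrite big_split/= [X in _ + X](_ : _ = \sum_l x l); last first.
  by rewrite [RHS](reindex_inj (inv_inj (flip_labelK i0))).
rewrite sumr_const card_ffun card_bool card_ord => le2.
have {le2} : \sum_l x l <= 2 ^+ n * (1 / 2 * B).
  have -> : 2 ^+ n * (1 / 2 * B) = (B *+ (2 ^ n)) / 2.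
    by rewrite -(mulr_natr B) natrX; field.
  by rewrite ler_pdivlMr// mulr_natr mulr2n.
move=> le; rewrite exprVn mulrC ler_pdivrMr ?exprn_gt0// mulrC//.
Qed.

End arw_on_coordinates.

Lemma limn_einf_ge (R : realType) (u : nat -> \bar R) (c : \bar R) (N : nat) :
  (forall k, (N <= k)%N -> (c <= u k)%E) -> (c <= limn_einf u)%E.
Proof.
move=> cu; rewrite limn_einf_lim; apply: lime_ge; first exact: is_cvg_einfs.
exists N => // k /= Nk; apply: le_ereal_inf_tmp => _ [m /= km <-].
exact/cu/(leq_trans Nk).
Qed.

(** * Asymptotics *)

Section powR_decay.
Context {R : realType}.

Lemma powR_le_eventually (c e : R) : 0 < c -> 0 < e ->
  exists N : nat, forall p : nat, (N <= p)%N -> p%:R `^ (- c) <= e.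
Proof.
move=> c0 e0; exists (Num.truncn (e `^ (- c^-1))).+1 => p Np.
have le : e `^ (- c^-1) <= p%:R :> R.
  have /andP[_ lt] := truncn_itv (powR_ge0 e (- c^-1)).
  by apply: (le_trans (ltW lt)); rewrite ler_nat.
have pc : (e `^ (- c^-1)) `^ c <= p%:R `^ c.
  by apply: ge0_ler_powR => //; rewrite ?nnegrE ?powR_ge0// ltW.
have pE : (e `^ (- c^-1)) `^ c = e^-1.
  by rewrite -powRrM mulNr mulVf ?gt_eqF// powRN powRr1// ltW.
rewrite pE in pc.
by rewrite powRN -[e]invrK lef_pV2// ?posrE ?invr_gt0// (lt_le_trans _ pc)//
  invr_gt0.
Qed.

End powR_decay.

Section arw_affinity.
Context {R : realType} {n p : nat}.
Local Notation I := (@arw_index n p).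
Local Notation V := (coord_space R I).
Context (Q : probability V R).
Hypothesis indepQ : forall B : I -> set (measurableTypeR R),
  (forall k, measurable (B k)) ->
  Q [set v | forall k, B k (v k)] = (\prod_k Q [set v | B k (v k)])%E.
Hypothesis gaussQ : forall (k : I) (B : set (measurableTypeR R)),
  k \in noise_set -> measurable B ->
  Q [set v | B (v k)] = normal_prob 0 1 B.
Variables (eps tau : R) (i0 : 'I_n) (l : {ffun 'I_n -> bool}) (j : 'I_p).
Hypothesis eps01 : 0 <= eps <= 1.

Let off (l' : {ffun 'I_n -> bool}) k :
  k \notin noise_set -> column_mean tau l' j k = 0.
Proof.
move=> kn; apply: column_mean_off; apply: contra kn.
exact: (fintype.subsetP (column_set_sub j)).
Qed.

Lemma column_affinity_ge_sparse :
  1 - eps * tau ^+ 2 / 2 <=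
  mixture_affinity Q eps
    (column_mean tau l j) (column_mean tau (flip_label i0 l) j).
Proof.
have := mixture_affinity_ge_sparse indepQ gaussQ (@off l)
  (@off (flip_label i0 l)) eps01.
rewrite sum_column_mean_sub_flip; congr (_ <= _); by field.
Qed.

(** With eps <= 1/2 the factor eps^2 / (4 (1 - eps)) is at most eps^2 / 2, which absorbs the 2 of c
    = 2 tau^2; the constant exp 1 bounds exp (n tau^2). *)
Lemma column_affinity_ge_dense : eps <= 1 / 2 -> n%:R * tau ^+ 2 <= 1 ->
  1 - expR 1 * (eps ^+ 2 * tau ^+ 2) <=
  mixture_affinity Q eps
    (column_mean tau l j) (column_mean tau (flip_label i0 l) j).
Proof.
move=> e2 nt; have /andP[e0 _] := eps01.
have e1 : eps < 1 by lra.
apply: le_trans (mixture_affinity_ge_dense indepQ gaussQ (@off l)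
  (@off (flip_label i0 l)) eps01 e1 (sum_column_mean_sqr tau j l)
  (sum_column_mean_sqr tau j (flip_label i0 l))
  (sum_column_meanM_flip tau i0 l j)).
rewrite lerB// [leRHS]mulrC.
have t0 : 0 <= tau ^+ 2 by exact: sqr_ge0.
have E : expR (n%:R * tau ^+ 2) <= expR 1 by rewrite ler_expR.
have -> : eps ^+ 2 * tau ^+ 2 * expR 1 =
  eps ^+ 2 / 2 * (expR 1 * (2 * tau ^+ 2)) by field.
apply: ler_pM.
- by rewrite divr_ge0 ?sqr_ge0//; lra.
- by rewrite mulr_ge0 ?expR_ge0//; lra.
- by rewrite ler_wpM2l ?sqr_ge0// lef_pV2 ?posrE//; lra.
- by rewrite ler_wpM2r//; lra.
Qed.

End arw_affinity.

(** * From an arbitrary probability space to the coordinate space *)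

Section arw_transfer.
Context (R : realType) (n p : nat) (eps tau : R) (d : measure_display)
  (T : measurableType d) (P : probability T R)
  (ell : 'I_n -> {RV P >-> bool}) (mu : 'I_p -> {RV P >-> R})
  (Z : 'I_n -> 'I_p -> {RV P >-> R}).
Hypothesis model : arw_model eps tau ell mu Z.
Local Notation I := (@arw_index n p).
Local Notation V := (coord_space R I).

Definition arw_vector (w : T) : V := fun k => arw_coord ell mu Z k w.

Lemma measurable_arw_coord (k : I) :
  measurable_fun setT (fun w => arw_coord ell mu Z k w : measurableTypeR R).
Proof.
move: k => [[i|j]|[i j]]/=;
  [|exact: (measurable_funP (mu j))|exact: (measurable_funP (Z i j))].
have ml : measurable_fun setT (label_val R) by [].
exact: (measurableT_comp ml (measurable_funP (ell i))).
Qed.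

Lemma measurable_arw_vector : measurable_fun setT arw_vector.
Proof.
by apply: measurable_into_coord_space => k; exact: measurable_arw_coord.
Qed.

HB.instance Definition _ :=
  isMeasurableFun.Build _ _ T V arw_vector measurable_arw_vector.

Let Q : probability V R := distribution P arw_vector.

Lemma arw_vector_indep (B : I -> set (measurableTypeR R)) :
  (forall k, measurable (B k)) ->
  Q [set v | forall k, B k (v k)] = (\prod_k Q [set v | B k (v k)])%E.
Proof.
move=> mB; have := arw_indep model [set: I]%SET mB.
rewrite (_ : \bigcap_(_ in _) _ =
  arw_vector @^-1` [set v | forall k, B k (v k)]); last first.
  apply/seteqP; split=> w /=; first by move=> h k; apply: h; rewrite /= inE.
  by move=> h k _; exact: h.
move=> h; rewrite -[LHS]/(P (arw_vector @^-1` [set v | forall k, B k (v k)])) h.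
by apply: eq_bigl => k; rewrite inE.
Qed.

Lemma arw_vector_noise (k : I) (B : set (measurableTypeR R)) :
  k \in noise_set -> measurable B ->
  Q [set v | B (v k)] = normal_prob 0 1 B.
Proof.
move: k => [[?|?]|[i j]]; rewrite inE// => _ mB.
by rewrite -(arw_Z_law model i j mB).
Qed.

Lemma arw_vector_label i b :
  Q [set v : V | v (inl (inl i)) = label_val R b] = (2^-1)%:E.
Proof.
rewrite -(arw_ell_law model i b); congr (P _).
apply/seteqP; split=> w /=; first exact: label_val_inj.
by rewrite /arw_vector/= => ->.
Qed.

Lemma arw_vector_mu j (b : bool) :
  Q [set v : V | v (inl (inr j)) = if b then tau else 0] =
  (if b then eps else 1 - eps)%:E.
Proof. by have [ht h0] := arw_mu_law model j; case: b. Qed.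

Lemma observed_arw_vector w : observed_mx (arw_vector w) = arw_X ell mu Z w.
Proof.
apply/matrixP => i j; rewrite !mxE big_ord1 !mxE.
by [].
Qed.

Lemma arw_error_ge (hatl : 'M[R]_(n, p) -> 'I_n -> bool) (pi : {perm bool})
    (i : 'I_n) (delta lam : R) :
  clustering_procedure hatl -> 0 <= eps <= 1 -> tau != 0 -> 0 < lam ->
  (forall l j, 1 - delta <=
    mixture_affinity Q eps
      (column_mean tau l j) (column_mean tau (flip_label i l) j)) ->
  ((1 / 2 - (lam / 4 * (p%:R * delta) + 1 / (2 * lam)))%:E <=
   P [set w | hatl (arw_X ell mu Z w) i != pi (ell i w)])%E.
Proof.
move=> mhat eps01 tau0 lam0 aff.
(* The permutation is absorbed into the guess, so one bound serves both permutations and the infimum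
   costs nothing. *)
pose h M := (pi^-1)%g (hatl M i).
have mh : measurable_fun setT
    (h : g_sigma_algebraType (@mx_cylinders R n p) -> bool).
  have mpi : measurable_fun setT ((pi^-1)%g : bool -> bool) by [].
  exact: (measurableT_comp mpi (mhat i)).
have := correct_prob_le arw_vector_indep arw_vector_noise arw_vector_label
  arw_vector_mu eps01 tau0 mh lam0 aff.
have mcorrect : measurable (arw_vector @^-1` (correct h i)).
  rewrite -[X in measurable X]setTI; apply: measurable_arw_vector => //.
  exact: measurable_correct.
have -> : [set w | hatl (arw_X ell mu Z w) i != pi (ell i w)] =
    ~` (arw_vector @^-1` (correct h i)).
  apply/seteqP; split=> w; rewrite /correct/= observed_arw_vector => hw.
    move=> /label_val_inj hl; move/negP: hw; apply; apply/eqP.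
    by rewrite -hl /h permKV.
  apply/negP => /eqP hl; apply: hw; congr (label_val R _).
  by rewrite /h hl permK.
rewrite probability_setC// => le.
have : (P (arw_vector @^-1` (correct h i)) <=
  (1 / 2 * (1 + lam / 2 * (p%:R * delta) + 1 / lam))%:E)%E by exact: le.
rewrite -[P _]fineK ?fin_num_measure// -EFinB !lee_fin => le2.
have -> : 1 / (2 * lam) = 1 / 2 * (1 / lam) by field; rewrite gt_eqF.
move: le2; set x := fine _; set y := p%:R * delta; set z := 1 / lam.
have -> : lam / 4 * y = 1 / 2 * (lam / 2 * y) by field.
set t := lam / 2 * y; lra.
Qed.

End arw_transfer.

Lemma hamm_ge (R : realType) (n p : nat) (d : measure_display)
    (T : measurableType d) (P : probability T R)
    (ell : 'I_n -> {RV P >-> bool}) (mu : 'I_p -> {RV P >-> R})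
    (Z : 'I_n -> 'I_p -> {RV P >-> R}) (hatl : 'M[R]_(n, p) -> 'I_n -> bool)
    (c : R) :
  (0 < n)%N ->
  (forall (pi : {perm bool}) i,
    (c%:E <= P [set w | hatl (arw_X ell mu Z w) i != pi (ell i w)])%E) ->
  (c%:E <= hamm ell mu Z hatl)%E.
Proof.
move=> n0 ce; rewrite /hamm.
have -> : c = n%:R^-1 * (n%:R * c).
  by rewrite mulrA mulVf ?mul1r// pnatr_eq0 -lt0n.
rewrite EFinM; apply: lee_wpmul2l; first by rewrite lee_fin invr_ge0.
apply: le_ereal_inf_tmp => _ [pi _ <-].
have -> : (n%:R * c)%:E = (\sum_(i < n) c%:E)%E.
  by rewrite sumEFin sumr_const card_ord mulr_natl.
by apply: lee_sum => i _; exact: ce.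
Qed.

Theorem theorem1p1 (R : realType) (theta beta alpha : R)
  (theta_gt0 : 0 < theta) (theta_lt1 : theta < 1)
  (beta_gt0 : 0 < beta) (beta_lt1 : beta < 1)
  (alpha_gt0 : 0 < alpha) (alpha_gt : eta_clu theta beta < alpha)
  (d : nat -> measure_display) (Omega : forall p : nat, measurableType (d p))
  (P : forall p : nat, probability (Omega p) R)
  (ell : forall p : nat, 'I_(arw_n theta p) -> {RV (P p) >-> bool})
  (mu : forall p : nat, 'I_p -> {RV (P p) >-> R})
  (Z : forall p : nat, 'I_(arw_n theta p) -> 'I_p -> {RV (P p) >-> R})
  (model : forall p : nat,
    arw_model (arw_eps beta p) (arw_tau alpha p) (@ell p) (@mu p) (@Z p))
  (hatl : forall p : nat,
    'M[R]_(arw_n theta p, p) -> 'I_(arw_n theta p) -> bool)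
  (hatlP : forall p : nat, clustering_procedure (@hatl p)) :
  ((2^-1)%:E <=
   limn_einf (fun p => hamm (@ell p) (@mu p) (@Z p) (@hatl p)))%E.
Proof.
apply/lee_addgt0Pr => e e0; rewrite -leeBlDr// -EFinB.
have eps01 p : (0 < p)%N -> 0 <= arw_eps beta p <= 1.
  move=> p0; rewrite powR_ge0/= -[leRHS](@powRr0 R p%:R).
  by apply: ler_powR; rewrite ?ler1n// oppr_le0 ltW.
have powM p (x y : R) : (0 < p)%N -> p%:R `^ x * p%:R `^ y = p%:R `^ (x + y).
  by move=> p0; rewrite powRD// pnatr_eq0 -lt0n p0 implybT.
have p1 p : p%:R = p%:R `^ 1 :> R by rewrite powRr1.
(* [delta] is the affinity defect of one column. The budget 2 e^2 for all p columns is what the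
   choice lam = 1 / e can afford: the Hellinger term is then at most e / 2, and 1 / (2 lam) is e /
   2. *)
suff [N HN] : exists N : nat, forall p, (N <= p)%N -> (0 < p)%N ->
    exists2 delta : R, p%:R * delta <= 2 * e ^+ 2 &
    forall (i : 'I_(arw_n theta p)) l j, 1 - delta <=
      mixture_affinity (distribution (P p) (arw_vector (@ell p) (@mu p) (@Z p)))
        (arw_eps beta p) (column_mean (arw_tau alpha p) l j)
        (column_mean (arw_tau alpha p) (flip_label i l) j).
  (* The successor forces p > 0, hence p^theta >= 1 and at least one label after rounding down. *)
  apply: (@limn_einf_ge _ _ _ N.+1) => p Np.
  have p0 : (0 < p)%N by exact: leq_trans Np.
  have [delta pdelta aff] := HN p (ltnW Np) p0.
  apply: hamm_ge.
    rewrite /arw_n truncn_gt0 -[leLHS](@powRr0 R p%:R).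
    by apply: ler_powR; rewrite ?ler1n// ltW.
  move=> pi i; have lam0 : 0 < 1 / e by rewrite divr_gt0.
  apply: le_trans
    (arw_error_ge (model p) pi (hatlP p) (eps01 p p0) _ lam0 (aff i)).
    rewrite lee_fin.
    have -> : 1 / (2 * (1 / e)) = e / 2 by field; rewrite gt_eqF.
    have : 1 / e / 4 * (p%:R * delta) <= 1 / e / 4 * (2 * e ^+ 2).
      by apply: ler_wpM2l => //; rewrite !divr_ge0// ltW.
    have -> : 1 / e / 4 * (2 * e ^+ 2) = e / 2 by field; rewrite gt_eqF.
    by set x := 1 / e / 4 * _; lra.
  by rewrite gt_eqF// powR_gt0// ltr0n.
(* The curve is the minimum of (1 - beta)/2 and max (theta/2, (1 - 2 beta)/2), so exceeding it means
   exceeding one of the two. *)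
have [[dense1 dense2]|sparse] :
    (theta / 2 < alpha /\ (1 - 2 * beta) / 2 < alpha) \/ (1 - beta) / 2 < alpha.
  move: alpha_gt; rewrite /eta_clu.
  have [le1|gt1] := leP beta ((1 - theta) / 2); first by left; split; lra.
  by have [le2|gt2] := leP beta (1 - theta); [left; split; lra|right].
(* This is the decay exponent of p eps^2 tau^2; dividing the target by exp 1 compensates the
   constant of the chi-square bound. *)
- have c0 : 0 < 2 * alpha + 2 * beta - 1 by lra.
  have e'0 : 0 < e ^+ 2 / expR 1 by rewrite divr_gt0 ?expR_gt0 ?exprn_gt0.
  have [N1 HN1] := powR_le_eventually c0 e'0.
  have [N2 HN2] := @powR_le_eventually R beta (1 / 2) beta_gt0 ltac:(lra).
  exists (maxn N1 N2) => p; rewrite geq_max => /andP[Np1 Np2] p0.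
  exists (expR 1 * (arw_eps beta p ^+ 2 * arw_tau alpha p ^+ 2)).
    have -> : p%:R * (expR 1 * (arw_eps beta p ^+ 2 * arw_tau alpha p ^+ 2)) =
        expR 1 * p%:R `^ (- (2 * alpha + 2 * beta - 1)).
      rewrite mulrCA /arw_eps /arw_tau !expr2 {1}(p1 p) !powM//.
      by congr (_ * _ `^ _); ring.
    apply: le_trans (ler_wpM2l (expR_ge0 1) (HN1 p Np1)) _.
    rewrite mulrCA divff ?gt_eqF ?expR_gt0// mulr1.
    by rewrite ler_peMl ?sqr_ge0//; lra.
  move=> i l j; apply: (column_affinity_ge_dense (arw_vector_indep (model p))
    (arw_vector_noise (model p)) _ _ _ (eps01 p p0)); first exact: HN2.
  (* Rounding down gives n <= p^theta, and theta - 2 alpha < 0 then gives n tau^2 <= 1. *)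
  apply: (@le_trans _ _ (p%:R `^ theta * arw_tau alpha p ^+ 2)).
    by rewrite ler_wpM2r ?sqr_ge0// /arw_n truncn_le powR_ge0.
  rewrite /arw_tau expr2 !powM// -[leRHS](@powRr0 R p%:R).
  by apply: ler_powR; rewrite ?ler1n//; lra.
(* The decay exponent of p eps tau^2; no bound on n tau^2 enters here. *)
- have c0 : 0 < 2 * alpha + beta - 1 by lra.
  have e'0 : 0 < e ^+ 2 by rewrite exprn_gt0.
  have [N1 HN1] := powR_le_eventually c0 e'0.
  exists N1 => p Np1 p0.
  exists (arw_eps beta p * arw_tau alpha p ^+ 2 / 2).
    have -> : p%:R * (arw_eps beta p * arw_tau alpha p ^+ 2 / 2) =
        p%:R `^ (- (2 * alpha + beta - 1)) / 2.
      rewrite mulrA; congr (_ / _).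
      rewrite /arw_eps /arw_tau !expr2 {1}(p1 p) !powM//.
      by congr (_ `^ _); ring.
    by have := HN1 p Np1; set x := _ `^ _; lra.
  move=> i l j; exact: (column_affinity_ge_sparse (arw_vector_indep (model p))
    (arw_vector_noise (model p)) _ _ _ _ (eps01 p p0)).
Qed.
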